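(* Let $q\ge1$ be an integer, $p>2q-1$ real, $X\in C_q^+$, and let $f\mapsto V_X(f)=\int_{C_q}f(H)\,d\mu_X(H)$ be the Dunkl intertwining operator (in the rational Dunkl setting, for the root system of type $BC$). Then the support of $V_X$ (that is, of the measure $\mu_X$) is $C(X)$.
   Context: Let $d\in\{1,2,4\}$. $C_q$ is the space of real diagonal matrices $X=\mathrm{diag}[x_1,\dots,x_q]$, identified with $\mathbf R^q$, and $C_q^+=\{X\in C_q:x_1>x_2>\dots>x_q>0\}$. The Weyl group $W$ acts on $C_q$ by permuting the $x_i$ and changing any number of their signs; $C(X)$ is the convex hull of $W\cdot X$. The root multiplicities are $m_{h_i}=d(p-q)$, $m_{2h_i}=d-1$, $m_{h_i\pm h_j}=d$ (with $h_i(X)=x_i$). The rational Dunkl operators are $T_\xi=\partial_\xi+\sum_{\alpha\in R_+}k_\alpha\,\alpha(\xi)\frac{1-r_\alpha}{\alpha(X)}$ with $k_\alpha=m_\alpha/2$ and $R_+=\{h_i,2h_i\ (1\le i\le q),\ h_i\pm h_j\ (i<j)\}$, $r_\alpha$ being the reflection in the hyperplane $\alpha=0$ acting on functions by $(r_\alpha f)(X)=f(r_\alpha X)$; equivalently the total parameter is $\frac12(d(p-q)+d-1)$ on each hyperplane $x_i=0$ and $\frac d2$ on each hyperplane $x_i=\pm x_j$. The Dunkl intertwining operator $V$ is the unique linear operator on polynomials on $C_q$ preserving homogeneous degree with $V1=1$ and $T_\xi V=V\partial_\xi$ for all $\xi$. For each $X$ there is a unique positive (probability) compactly supported measure $\mu_X$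 on $C_q$ with $(Vf)(X)=V_X(f)=\int_{C_q}f(H)\,d\mu_X(H)$. *)

(* Defs.v *)
(* This file uses the MathComp-Analysis library. The notations of [mpoly] are
   left out on import because they clash with those of MathComp-Analysis. *)
From HB Require Import structures.
From mathcomp Require Import all_boot all_order all_algebra all_fingroup.
From mathcomp Require Import -(notations) mpoly.
From mathcomp Require Import all_classical all_reals all_analysis.

Set Implicit Arguments.
Unset Strict Implicit.
Unset Printing Implicit Defensive.

Import Order.TTheory GRing.Theory Num.Theory.
Import numFieldNormedType.Exports.
Local Open Scope classical_set_scope.
Local Open Scope ring_scope.

(* The space C_q is identified with 'rV[R]_q; a linear form on C_q is given by
   the row vector of its coefficients. [f.@Cq[x]] is the value of the polynomial
   [f] at the point [x]. *)
Notation polyCq R q := (mpoly q R).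
Notation polyCqX i := (mpolyX _ (mnm1 i)).
Notation "f .@Cq[ x ]" := (meval (fun i => x 0 i) f)
  (at level 2, format "f .@Cq[ x ]") : ring_scope.

Section LinearForms.
Context {R : realType} {q : nat}.
Implicit Types (a x xi : 'rV[R]_q) (f g : polyCq R q).

Definition root_app a x : R := \sum_j a 0 j * x 0 j.

Definition root_poly a : polyCq R q := \sum_j a 0 j *: polyCqX j.

Definition root_refl a x : 'rV[R]_q :=
  x - (2 * root_app a x / root_app a a) *: a.

(* The polynomial X |-> f (root_refl a X), cf. [root_refl_polyE]. *)
Definition root_refl_poly a f : polyCq R q :=
  comp_mpoly
    [tuple polyCqX i - (2 * a 0 i / root_app a a) *: root_poly a | i < q] f.

Lemma root_polyE a x : (root_poly a).@Cq[x] = root_app a x.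
Proof.
rewrite /root_poly raddf_sum; apply: eq_bigr => j _.
by rewrite /= mevalZ mevalXU.
Qed.

Lemma root_refl_polyE a f x :
  (root_refl_poly a f).@Cq[x] = f.@Cq[root_refl a x].
Proof.
rewrite /root_refl_poly comp_mpoly_meval; apply: meval_eq => i.
rewrite tnth_mktuple mevalB mevalXU mevalZ root_polyE !mxE.
by congr (_ - _); rewrite mulrAC -!mulrA [a 0 i * _]mulrC -!mulrA.
Qed.

(* The polynomial (f - r_a f) / a. By [dunkl_quotP] the division is exact, and
   for a != 0 the quotient is unique because polynomials form a domain. *)
Definition dunkl_quot a f : polyCq R q :=
  xget 0 [set g | root_poly a * g = f - root_refl_poly a f].

Lemma dunkl_quotP a f :
  root_poly a * dunkl_quot a f = f - root_refl_poly a f.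
Proof.
pose P h := exists g, root_poly a * g = h - root_refl_poly a h.
suff Pf : P f by exact: (@xgetPex _ 0 [set g | root_poly a * g = _] Pf).
have PM h1 h2 : P h1 -> P h2 -> P (h1 * h2).
  move=> [g1 e1] [g2 e2]; exists (g1 * h2 + root_refl_poly a h1 * g2).
  rewrite mulrDr mulrA e1 mulrCA e2 /root_refl_poly rmorphM /=.
  by rewrite mulrBl mulrBr addrA subrK.
have P1 : P 1.
  by exists 0; rewrite mulr0 /root_refl_poly comp_mpoly1 subrr.
elim/mpolyind: f => [|c m f _ _ [g e]].
  by exists 0; rewrite mulr0 /root_refl_poly comp_mpoly0 subrr.
have [g' e'] : P (mpolyX _ m).
  rewrite mpolyXE_id; elim/big_ind: _ => // i _.
  elim: (m i) => [|n IH]; first by rewrite expr0.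
  rewrite exprS; apply: PM => //.
  exists (mpolyC q (2 * a 0 i / root_app a a)).
  rewrite /root_refl_poly comp_mpolyXU -tnth_nth tnth_mktuple subKr.
  by rewrite mulrC mul_mpolyC.
exists (c *: g' + g); rewrite mulrDr e -scalerAr e' /root_refl_poly.
by rewrite comp_mpolyD comp_mpolyZ scalerBr opprD addrACA.
Qed.

Definition dir_deriv xi f : polyCq R q := \sum_i xi 0 i *: mderiv i f.

End LinearForms.

Section DunklBC.
Context {R : realType} {q : nat}.
Implicit Types (xi x y : 'rV[R]_q) (f : polyCq R q).

Definition root_h (i : 'I_q) : 'rV[R]_q := delta_mx 0 i.

Definition mult_h (d : nat) (p : R) : R := d%:R * (p - q%:R).
Definition mult_2h (d : nat) : R := d%:R - 1.
Definition mult_hh (d : nat) : R := d%:R.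

Definition dunkl_term (m : R) (a xi : 'rV[R]_q) f : polyCq R q :=
  (m / 2 * root_app a xi) *: dunkl_quot a f.

Definition dunkl_op (d : nat) (p : R) xi f : polyCq R q :=
  dir_deriv xi f
  + \sum_(i < q) (dunkl_term (mult_h d p) (root_h i) xi f
                  + dunkl_term (mult_2h d) (2 *: root_h i) xi f)
  + \sum_(i < q) \sum_(j < q | (i < j)%N)
      (dunkl_term (mult_hh d) (root_h i - root_h j) xi f
       + dunkl_term (mult_hh d) (root_h i + root_h j) xi f).

Definition is_dunkl_intertwiner (d : nat) (p : R)
    (V : {linear polyCq R q -> polyCq R q}) : Prop :=
  [/\ forall n f, f \is ishomog1 n (@mdeg q) -> V f \is ishomog1 n (@mdeg q),
      V 1 = 1 &
      forall xi f, dunkl_op d p xi (V f) = V (dir_deriv xi f)].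

Definition pos_chamber : set 'rV[R]_q :=
  [set x | (forall i j : 'I_q, (i < j)%N -> x 0 j < x 0 i) /\
           (forall i : 'I_q, 0 < x 0 i)].

Definition weyl_orbit x : set 'rV[R]_q :=
  [set y | exists (s : 'S_q) (e : {ffun 'I_q -> bool}),
     y = \row_i ((-1) ^+ e i * x 0 (s i))].

Definition conv_hull (A : set 'rV[R]_q) : set 'rV[R]_q :=
  smallest (@convex_set R 'rV[R]_q) A.

End DunklBC.

Definition borelCq (R : realType) (q : nat) : measurableType _ :=
  g_sigma_algebraType (@open 'rV[R]_q).

Definition measure_support {R : realType} {T : topologicalType}
    (mu : set T -> \bar R) : set T :=
  [set x | forall U : set T, open U -> U x -> (0 < mu U)%E].

Definition represents {R : realType} {q : nat}
    (V : polyCq R q -> polyCq R q) (X : 'rV[R]_q)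
    (mu : probability (borelCq R q) R) : Prop :=
  forall f : polyCq R q,
    ((V f).@Cq[X])%:E = (\int[mu]_H (f.@Cq[(H : 'rV[R]_q)])%:E)%E.

(* Main.v *)
Require Import Defs.
From HB Require Import structures.
From mathcomp Require Import all_boot all_order all_algebra all_fingroup.
From mathcomp Require Import -(notations) mpoly.
From mathcomp Require Import all_classical all_reals all_analysis.
From mathcomp Require Import measurable_realfun ring lra.
From mathcomp Require polyrcf.
Import Order.TTheory GRing.Theory Num.Theory.
Import numFieldNormedType.Exports.
Local Open Scope classical_set_scope.
Local Open Scope ring_scope.

(** In [T_xi (V f) = V (D_xi f)], with [D_xi] the derivative in the direction
    [xi], take [xi] equal to the point [x] of evaluation.  All denominators of
    the Dunkl operator cancel, and for [f] homogeneous of degree [n] there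
    remains the identity
      [n (V f)(x) + sum_r k_r ((V f)(x) - (V f)(r x)) = (V (D_x f))(x)],
    a sum over the reflections [r], which only involves the values of
    polynomials on the Weyl orbit of [x] ([intertwiner_homog]).  Written along
    the segment from [0] to [x], it is the Feynman-Kac equation of a Markov
    chain [w_t] in the Weyl group that starts at the identity at time [1] and,
    as [t] decreases to [0], jumps from [w] to [r w] with rate [k_r / t];
    [mu_X] is the law of the integral of [w_t X] over [0 <= t <= 1].  Since all
    the rates are positive, the chain spends arbitrary proportions of time at
    the points of the orbit, which is why the support is the whole convex hull.
    The proof replaces the chain by two consequences of the identity.

    The support lies in the hull: at a point of the orbit where a polynomial
    is largest in absolute value, the sum over the reflections has the sign of
    that polynomial ([refl_defect_max]).  Hence a linear form [l] with [|l| <= M]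
    on the orbit satisfies [|V (l ^ n)| <= M ^ n] there
    ([intertwiner_moment_le]), so [mu_X] does not charge [l ^ 2 > c] when
    [c > M ^ 2] ([tail_negligible]), and linear forms separate points from the
    hull ([separation]).

    The hull lies in the support: the maximum principle also shows that [V]
    commutes with the Weyl group ([intertwiner_signed_perm]), so that all the
    values [(V f)(r X)] are integrals against [mu_X] too.  The equation obtained
    by conditioning on the first jump then bounds [(V f)(X)] from below
    ([first_jump_ge]), and evaluating it on polynomials that peak at a given
    point shows that the support [S] contains [X] and the points
    [(1 - s) X + s (r y)] for [y] in [S] and [0 <= s <= 1] ([support_step]).
    Consequently [S] is stable under the Weyl group and star-shaped around each
    point of the orbit, and the points around which a set is star-shaped form a
    convex set ([star_kernel_convex]). *)

Set Implicit Arguments.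
Unset Strict Implicit.
Unset Printing Implicit Defensive.

(** * Reflections and the radial part of the Dunkl operators *)

Lemma sum_prod_bool (V : nmodType) q (F : 'I_q * 'I_q * bool -> V) :
  \sum_u F u = \sum_i \sum_j (F (i, j, true) + F (i, j, false)).
Proof.
rewrite (pair_bigA _ (fun i j => F (i, j, true) + F (i, j, false))) /=.
transitivity (\sum_(u : 'I_q * 'I_q) \sum_b F (u, b)).
  by rewrite pair_bigA; apply: eq_bigr => -[u b] _.
by apply: eq_bigr => -[i j] _; exact: big_bool.
Qed.

Section Reflections.
Context {R : realType} {q : nat}.
Implicit Types (a x y : 'rV[R]_q) (f g : polyCq R q).

Lemma root_appC a x : root_app a x = root_app x a.
Proof. by apply: eq_bigr => j _; rewrite mulrC. Qed.

Lemma root_appDr a x y : root_app a (x + y) = root_app a x + root_app a y.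
Proof. by rewrite -big_split; apply: eq_bigr => j _; rewrite mxE mulrDr. Qed.

Lemma root_appZr a c x : root_app a (c *: x) = c * root_app a x.
Proof. by rewrite mulr_sumr; apply: eq_bigr => j _; rewrite mxE mulrCA. Qed.

Lemma root_appNr a x : root_app a (- x) = - root_app a x.
Proof. by rewrite -scaleN1r root_appZr mulN1r. Qed.

Lemma root_appDl a b x : root_app (a + b) x = root_app a x + root_app b x.
Proof. by rewrite root_appC root_appDr !(root_appC x). Qed.

Lemma root_appZl c a x : root_app (c *: a) x = c * root_app a x.
Proof. by rewrite root_appC root_appZr root_appC. Qed.

Lemma root_appNl a x : root_app (- a) x = - root_app a x.
Proof. by rewrite root_appC root_appNr root_appC. Qed.

Lemma root_reflZ c a x : c != 0 -> root_refl (c *: a) x = root_refl a x.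
Proof.
move=> c0; rewrite /root_refl !root_appZl !root_appZr scalerA.
have [->|a0] := eqVneq (root_app a a) 0; first by rewrite !(mulr0, invr0, mul0r).
by congr (_ - _ *: _); field; rewrite a0 c0.
Qed.

Definition refl_index : finType := ('I_q + 'I_q * 'I_q * bool)%type.

Definition bc_root (a : refl_index) : 'rV[R]_q :=
  match a with
  | inl i => root_h i
  | inr (i, j, b) => root_h i + (-1) ^+ b *: root_h j
  end.

(** The roots [h_i] and [2 h_i] define the same reflection, whence a sum of
    two multiplicities.  The pairs [(i, j)] and [(j, i)] also define the same
    reflection, whence [m / 4] in place of [m / 2]. *)
Definition bc_weight (d : nat) (p : R) (a : refl_index) : R :=
  match a with
  | inl i => (mult_h (q := q) d p + mult_2h d) / 2
  | inr (i, j, _) => if i != j then mult_hh d / 4 else 0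
  end.

Definition refl_defect (d : nat) (p : R) (g : 'rV[R]_q -> R) x : R :=
  \sum_a bc_weight d p a * (g x - g (root_refl (bc_root a) x)).

Lemma meval_sum I (r : seq I) (P : pred I) (F : I -> polyCq R q) x :
  (\sum_(i <- r | P i) F i).@Cq[x] = \sum_(i <- r | P i) (F i).@Cq[x].
Proof. exact: (big_morph _ (@mevalD _ _ _) (@meval0 _ _ _)). Qed.

Lemma dunkl_term_radial m a f x :
  (dunkl_term m a x f).@Cq[x] = m / 2 * (f.@Cq[x] - f.@Cq[root_refl a x]).
Proof.
rewrite mevalZ -[LHS]mulrA; congr (_ * _).
rewrite -root_polyE -mevalM dunkl_quotP mevalB root_refl_polyE.
 by [].
Qed.

Lemma sum_ltn_sym (F : 'I_q -> 'I_q -> R) :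
    (forall i j, F i j = F j i) ->
  \sum_(i < q) \sum_(j < q | (i < j)%N) F i j =
  2^-1 * \sum_(i < q) \sum_(j < q | i != j) F i j.
Proof.
move=> Fsym; set S := LHS.
have -> : \sum_(i < q) \sum_(j < q | i != j) F i j =
    S + \sum_(i < q) \sum_(j < q | (j < i)%N) F i j.
  rewrite -big_split; apply: eq_bigr => i _.
  rewrite (bigID (fun j : 'I_q => (i < j)%N)) /=; congr (_ + _).
    by apply: eq_bigl => j; rewrite -(inj_eq val_inj); case: ltngtP.
  by apply: eq_bigl => j; rewrite -(inj_eq val_inj); case: ltngtP.
suff -> : \sum_(i < q) \sum_(j < q | (j < i)%N) F i j = S by field.
rewrite (exchange_big_dep xpredT) //=; apply: eq_bigr => i _.
by apply: eq_bigr => j _; exact: Fsym.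
Qed.

(** Taking the direction [xi] equal to the point [x] cancels all denominators
    of the Dunkl operator: what remains is the radial derivative and a
    difference operator on the Weyl orbit of [x]. *)
Lemma dunkl_op_radial d p f x :
  (dunkl_op d p x f).@Cq[x] =
  (dir_deriv x f).@Cq[x] + refl_defect d p (fun y => f.@Cq[y]) x.
Proof.
rewrite /dunkl_op !mevalD -addrA !meval_sum; congr (_ + _).
rewrite /refl_defect big_sumType /=; congr (_ + _).
  apply: eq_bigr => i _.
  rewrite [LHS]mevalD [X in X + _]dunkl_term_radial [X in _ + X]dunkl_term_radial.
  rewrite (_ : root_refl (2 *: root_h i) x = root_refl (root_h i) x); last first.
    by apply: root_reflZ; rewrite pnatr_eq0.
  by rewrite [in RHS]mulrDl [in RHS]mulrDl.
pose F i j : R := (mult_hh d / 2) *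
  ((f.@Cq[x] - f.@Cq[root_refl (root_h i - root_h j) x]) +
   (f.@Cq[x] - f.@Cq[root_refl (root_h i + root_h j) x])).
transitivity (\sum_(i < q) \sum_(j < q | (i < j)%N) F i j).
  apply: eq_bigr => i _; rewrite meval_sum; apply: eq_bigr => j _.
  rewrite [LHS]mevalD [X in X + _]dunkl_term_radial [X in _ + X]dunkl_term_radial.
  by rewrite -mulrDr.
rewrite sum_ltn_sym; last first.
  move=> i j; rewrite /F [root_h j + root_h i]addrC -[root_h j - root_h i]opprB.
  by rewrite -[- (root_h i - root_h j)]scaleN1r root_reflZ// oppr_eq0 oner_eq0.
rewrite mulr_sumr sum_prod_bool; apply: eq_bigr => i _.
rewrite mulr_sumr big_mkcond; apply: eq_bigr => j _ /=.
rewrite expr0 expr1 scaleN1r scale1r /F.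
by case: eqP => _ /=; [rewrite !mul0r addr0 | field].
Qed.

End Reflections.
Arguments refl_index : clear implicits.

(** * Signed permutations *)

Section SignedPermutations.
Context {R : realType} {q : nat}.
Implicit Types (x y : 'rV[R]_q) (s : 'S_q) (e : {ffun 'I_q -> bool}).

Definition signed_perm s e x : 'rV[R]_q := \row_i ((-1) ^+ e i * x 0 (s i)).

Definition signed_perm_inv s e : 'rV[R]_q -> 'rV[R]_q :=
  signed_perm s^-1 [ffun j => e (s^-1%g j)].

Lemma signed_permD s e x y :
  signed_perm s e (x + y) = signed_perm s e x + signed_perm s e y.
Proof. by apply/rowP => i; rewrite !mxE mulrDr. Qed.

Lemma signed_permZ s e c x : signed_perm s e (c *: x) = c *: signed_perm s e x.
Proof. by apply/rowP => i; rewrite !mxE mulrCA. Qed.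

Lemma signed_permB s e x y :
  signed_perm s e (x - y) = signed_perm s e x - signed_perm s e y.
Proof. by rewrite -scaleN1r signed_permD signed_permZ scaleN1r. Qed.

Lemma signed_perm_comp s e t c x :
  signed_perm s e (signed_perm t c x) =
  signed_perm (s * t)%g [ffun i => e i (+) c (s i)] x.
Proof. by apply/rowP => i; rewrite !mxE ffunE permM signr_addb mulrA. Qed.

Lemma signed_perm1 x : signed_perm 1 [ffun=> false] x = x.
Proof. by apply/rowP => i; rewrite !mxE ffunE perm1 mul1r. Qed.

Lemma signed_perm_invK s e : cancel (signed_perm_inv s e) (signed_perm s e).
Proof.
move=> x; rewrite /signed_perm_inv signed_perm_comp mulgV -[RHS]signed_perm1.
by congr (signed_perm _ _ _); apply/ffunP => i; rewrite !ffunE permK addbb.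
Qed.

Lemma root_app_signed_perm s e x y :
  root_app (signed_perm s e x) (signed_perm s e y) = root_app x y.
Proof.
rewrite /root_app [RHS](reindex_inj (@perm_inj _ s)).
by apply: eq_bigr => i _; rewrite !mxE mulrACA -signr_addb addbb mul1r.
Qed.

Lemma root_refl_signed_perm a s e x :
  root_refl a (signed_perm s e x) =
  signed_perm s e (root_refl (signed_perm_inv s e a) x).
Proof.
rewrite /root_refl -[in LHS](signed_perm_invK s e a) !root_app_signed_perm.
by rewrite signed_permB signed_permZ.
Qed.

Definition index_act s e (a : refl_index q) : refl_index q :=
  match a with
  | inl i => inl (s i)
  | inr (i, j, b) => inr (s i, s j, b (+) e i (+) e j)
  end.

Lemma index_act_inj s e : injective (index_act s e).
Proof.
move=> [i|[[i j] b]] [i'|[[i' j'] b']] //=; first by case=> /perm_inj ->.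
case=> /perm_inj -> /perm_inj -> /addIb /addIb -> //.
Qed.

Lemma signed_perm_inv_h s e i :
  signed_perm_inv s e (root_h i) = (-1) ^+ e i *: root_h (s i) :> 'rV[R]_q.
Proof.
apply/rowP => k; rewrite !mxE ffunE eqxx /= -(inj_eq (@perm_inj _ s)) permKV.
by case: eqP => [->|_]; rewrite ?permK ?mulr0.
Qed.

Lemma signed_perm_inv_root s e a : exists2 c : R, c != 0 &
  signed_perm_inv s e (bc_root a) = c *: bc_root (index_act s e a).
Proof.
case: a => [i|[[i j] b]] /=.
  by exists ((-1) ^+ e i); [rewrite signr_eq0 | rewrite signed_perm_inv_h].
exists ((-1) ^+ e i); first by rewrite signr_eq0.
rewrite /signed_perm_inv signed_permD signed_permZ.
rewrite -!/(signed_perm_inv s e _) !signed_perm_inv_h scalerDr !scalerA.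
by congr (_ + _ *: _); rewrite -!signr_addb; do 2!f_equal; case: b (e i) (e j) => [] [] [].
Qed.

Lemma bc_weight_act d p s e a :
  bc_weight d p (index_act s e a) = bc_weight d p a :> R.
Proof. by case: a => [i|[[i j] b]] //=; rewrite (inj_eq (@perm_inj _ s)). Qed.

(** A signed permutation permutes the reflections of the root system and the
    multiplicities are constant along its action. *)
Lemma refl_defect_signed_perm d p (g : 'rV[R]_q -> R) s e x :
  refl_defect d p g (signed_perm s e x) =
  refl_defect d p (g \o signed_perm s e) x.
Proof.
rewrite /refl_defect [RHS](reindex_inj (@index_act_inj s e)).
apply: eq_bigr => a _; rewrite bc_weight_act /= root_refl_signed_perm.
by have [c c0 ->] := signed_perm_inv_root s e a; rewrite (root_reflZ _ _ c0).
Qed.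

(** The indices of actual roots: [h_i - h_i = 0] and [h_i + h_i] are excluded,
    and have weight zero. *)
Definition proper_index (a : refl_index q) :=
  if a is inr (i, j, _) then i != j else true.

Lemma root_app_h i x : root_app (root_h i) x = x 0 i.
Proof.
rewrite /root_app (bigD1 i) //= big1 ?addr0 => [|j ji].
  by rewrite mxE !eqxx mul1r.
by rewrite mxE eqxx (negbTE ji) mul0r.
Qed.

Lemma root_refl_h i x : root_refl (root_h i) x =
  signed_perm 1 [ffun k => k == i] x.
Proof.
apply/rowP => k; rewrite /root_refl !root_app_h !mxE ffunE perm1 !eqxx /= divr1.
by case: eqP => [->|_] /=; rewrite ?expr1 ?expr0 ?mulr0 ?mulr1; ring.
Qed.

Lemma root_refl_hh i j b x : i != j ->
  root_refl (bc_root (inr (i, j, b))) x =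
  signed_perm (tperm i j) [ffun k => ((k == i) || (k == j)) && ~~ b] x.
Proof.
move=> ij; have ji : j != i by rewrite eq_sym.
have aE y : root_app (bc_root (inr (i, j, b))) y = y 0 i + (-1) ^+ b * y 0 j.
  by rewrite /= root_appDl root_appZl !root_app_h.
rewrite /root_refl !aE; apply/rowP => k.
rewrite !mxE ffunE !eqxx /= (negbTE ij) (negbTE ji) /=.
case: tpermP => [->|->|/eqP ki /eqP kj].
- rewrite eqxx (negbTE ij) /=.
  by case: b {aE} => /=; field.
- rewrite eqxx (negbTE ji) /=.
  by case: b {aE} => /=; field.
- rewrite (negbTE ki) (negbTE kj) /=.
  by case: b {aE} => /=; field.
Qed.

Lemma root_refl_bc a : proper_index a ->
  exists s e, forall x, root_refl (bc_root a) x = signed_perm s e x.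
Proof.
case: a => [i _|[[i j] b] /= ij].
  by exists 1%g, [ffun k => k == i] => x; exact: root_refl_h.
by exists (tperm i j), [ffun k => ((k == i) || (k == j)) && ~~ b] => x;
  exact: (root_refl_hh b x ij).
Qed.

(** The reflections generate the group of signed permutations. *)
Lemma signed_perm_stable (S : set 'rV[R]_q) :
    (forall a x, proper_index a -> S x -> S (root_refl (bc_root a) x)) ->
  forall s e x, S x -> S (signed_perm s e x).
Proof.
move=> Srefl s e x Sx.
have Ss y t : S y -> S (signed_perm t [ffun=> false] y).
  have [ts -> pts] := prod_tpermP t.
  elim: ts pts y => [_|[i j] ts IH /= /andP[ij pts]] y Sy.
    by rewrite big_nil signed_perm1.
  rewrite big_cons (_ : signed_perm _ _ y =
    signed_perm (tperm i j) [ffun=> false]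
      (signed_perm (\prod_(u <- ts) tperm u.1 u.2)%g [ffun=> false] y)).
    have -> z : signed_perm (tperm i j) [ffun=> false] z =
        root_refl (bc_root (inr (i, j, true))) z.
      rewrite root_refl_hh//; congr signed_perm.
      by apply/ffunP => k; rewrite !ffunE andbF.
    by apply: Srefl => //; exact: IH.
  by rewrite signed_perm_comp; congr signed_perm; apply/ffunP => k; rewrite !ffunE.
have Se y (r : seq 'I_q) : uniq r -> S y ->
    S (signed_perm 1 [ffun k => k \in r] y).
  move=> + Sy; elim: r => [_|i r IH /= /andP[ir ur]].
    rewrite (_ : [ffun k : 'I_q => k \in [::]] = [ffun=> false]) ?signed_perm1//.
  suff -> : signed_perm 1 [ffun k => k \in i :: r] y =
      root_refl (bc_root (inl i)) (signed_perm 1 [ffun k => k \in r] y).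
    by apply: Srefl => //; exact: IH.
  rewrite root_refl_h signed_perm_comp mul1g; congr signed_perm.
  apply/ffunP => k; rewrite !ffunE perm1 in_cons.
  by case: eqP => [->|]//=; rewrite ir.
rewrite (_ : signed_perm s e x = signed_perm 1 [ffun k => k \in enum [pred i | e i]]
  (signed_perm s [ffun=> false] x)).
  by apply: Se; [exact: enum_uniq | exact: Ss].
rewrite signed_perm_comp mul1g; congr signed_perm.
by apply/ffunP => k; rewrite !ffunE addbF mem_enum inE.
Qed.

End SignedPermutations.

(** * The Euler operator and directional derivatives *)

Section EulerIdentity.
Context {R : realType} {q : nat}.
Implicit Types (x y : 'rV[R]_q) (f g : polyCq R q) (s : 'S_q)
  (e : {ffun 'I_q -> bool}).

Definition euler f : polyCq R q := \sum_i polyCqX i * mderiv i f.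

Lemma euler_meval f x : (euler f).@Cq[x] = (dir_deriv x f).@Cq[x].
Proof.
rewrite !meval_sum; apply: eq_bigr => i _.
by rewrite mevalM mevalXU mevalZ.
Qed.

Lemma eulerX m : euler (mpolyX R m) = (mdeg m)%:R *: mpolyX R m.
Proof.
rewrite mdegE natr_sum scaler_suml; apply: eq_bigr => i _.
rewrite mderivX -scalerAr; have [->|mi] := eqVneq (m i) 0%N.
  by rewrite !scale0r.
congr (_ *: _); rewrite -mpolyXD addmC submK//.
by apply/mnm_lepP => j; rewrite mnm1E; case: eqP => [<-|//]; rewrite lt0n.
Qed.

Lemma eulerD f g : euler (f + g) = euler f + euler g.
Proof. by rewrite -big_split; apply: eq_bigr => i _; rewrite mderivD mulrDr. Qed.

Lemma eulerZ c f : euler (c *: f) = c *: euler f.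
Proof.
by rewrite scaler_sumr; apply: eq_bigr => i _; rewrite mderivZ scalerAr.
Qed.

Lemma eulerM f g : euler (f * g) = euler f * g + f * euler g.
Proof.
rewrite mulr_suml mulr_sumr -big_split; apply: eq_bigr => i _ /=.
by rewrite mderivM; ring.
Qed.

Lemma eulerC (c : R) : euler (mpolyC q c) = 0.
Proof. by apply: big1 => i _; rewrite mderivC mulr0. Qed.

Lemma eulerXU i : euler (polyCqX i) = polyCqX i :> polyCq R q.
Proof. by rewrite eulerX mdeg1 scale1r. Qed.

Lemma euler_homog n f :
  f \is ishomog1 n (@mdeg q) -> euler f = n%:R *: f.
Proof.
move=> /dhomogP fn; rewrite [in LHS](mpolyE f) [in RHS](mpolyE f).
have euler0 : euler 0 = 0 by rewrite -(scale0r 0) eulerZ !scale0r.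
rewrite (big_morph _ eulerD euler0) scaler_sumr big_seq [RHS]big_seq.
by apply: eq_bigr => m /fn <-; rewrite eulerZ eulerX !scalerA mulrC.
Qed.

Lemma dir_derivD x f g : dir_deriv x (f + g) = dir_deriv x f + dir_deriv x g.
Proof. by rewrite -big_split; apply: eq_bigr => i _; rewrite mderivD scalerDr. Qed.

Lemma dir_derivZ x c f : dir_deriv x (c *: f) = c *: dir_deriv x f.
Proof.
rewrite scaler_sumr; apply: eq_bigr => i _.
by rewrite mderivZ !scalerA mulrC.
Qed.

Lemma dir_derivM x f g :
  dir_deriv x (f * g) = dir_deriv x f * g + f * dir_deriv x g.
Proof.
rewrite mulr_suml mulr_sumr -big_split; apply: eq_bigr => i _.
by rewrite mderivM scalerDr scalerAl scalerAr.
Qed.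

Lemma dir_derivC x c : dir_deriv x (mpolyC q c) = 0.
Proof. by apply: big1 => i _; rewrite mderivC scaler0. Qed.

Lemma dir_derivXU x i : dir_deriv x (polyCqX i) = mpolyC q (x 0 i).
Proof.
rewrite /dir_deriv (bigD1 i) //= big1 ?addr0 => [|j ji].
  rewrite mderivX mnm1E eqxx scale1r -mul_mpolyC.
  have -> : mnm_sub (mnm1 i) (mnm1 i) = mnm0 by apply/mnmP => k; rewrite mnmBE mnm0E subnn.
  by rewrite mpolyX0 mulr1.
by rewrite mderivX mnm1E eq_sym (negbTE ji) scale0r scaler0.
Qed.

Lemma dir_deriv_homog n x f : f \is ishomog1 n.+1 (@mdeg q) ->
  dir_deriv x f \is ishomog1 n (@mdeg q).
Proof.
move=> /dhomogP fn; rewrite rpred_sum// => i _; rewrite rpredZ//.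
apply/dhomogP => m; rewrite mcoeff_msupp mcoeff_mderiv => fm.
have /fn : mnm_add m (mnm1 i) \in msupp f.
  by rewrite mcoeff_msupp; apply: contraNneq fm => ->; rewrite mul0rn.
by rewrite /= mdegD mdeg1 addn1 => -[].
Qed.

End EulerIdentity.

(** * The Weyl group acting on polynomials, and the signs of the weights *)

Section WeylAction.
Context {R : realType} {q : nat}.
Implicit Types (x y : 'rV[R]_q) (f g : polyCq R q) (s : 'S_q)
  (e : {ffun 'I_q -> bool}).

(** The polynomial [X |-> f (signed_perm s e X)]. *)
Definition signed_perm_poly s e f : polyCq R q :=
  comp_mpoly [tuple (-1) ^+ e i *: polyCqX (s i) | i < q] f.

Lemma signed_perm_polyE s e f x :
  (signed_perm_poly s e f).@Cq[x] = f.@Cq[signed_perm s e x].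
Proof.
rewrite /signed_perm_poly comp_mpoly_meval; apply: meval_eq => i.
by rewrite tnth_mktuple mevalZ mevalXU mxE.
Qed.

Lemma signed_perm_polyD s e f g : signed_perm_poly s e (f + g) =
  signed_perm_poly s e f + signed_perm_poly s e g.
Proof. exact: comp_mpolyD. Qed.

Lemma signed_perm_polyZ s e c f :
  signed_perm_poly s e (c *: f) = c *: signed_perm_poly s e f.
Proof. exact: comp_mpolyZ. Qed.

Lemma signed_perm_polyM s e f g : signed_perm_poly s e (f * g) =
  signed_perm_poly s e f * signed_perm_poly s e g.
Proof. exact: rmorphM. Qed.

Lemma signed_perm_polyC s e c :
  signed_perm_poly s e (mpolyC q c) = mpolyC q c.
Proof. exact: comp_mpolyC. Qed.

Lemma signed_perm_polyXU s e i :
  signed_perm_poly s e (polyCqX i) = (-1) ^+ e i *: polyCqX (s i).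
Proof. by rewrite /signed_perm_poly comp_mpolyXU -tnth_nth tnth_mktuple. Qed.

Lemma signed_perm_poly_homog s e n f : f \is ishomog1 n (@mdeg q) ->
  signed_perm_poly s e f \is ishomog1 n (@mdeg q).
Proof.
move=> /dhomogP fn; rewrite /signed_perm_poly comp_mpolyEX.
rewrite big_seq rpred_sum// => m /fn <-; rewrite rpredZ// comp_mpolyX /= mdegE.
elim/big_ind2: _ => [|f1 n1 f2 n2|i _]; first exact: dhomog1.
  exact: dhomogM.
rewrite tnth_mktuple.
have t1 : ((-1) ^+ e i *: polyCqX (s i) : polyCq R q) \is ishomog1 1 (@mdeg q).
  by rewrite rpredZ// dhomogX /= mdeg1.
by have := dhomogMn (m i) t1; rewrite mul1n.
Qed.

Lemma dir_deriv_signed_perm s e f x :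
  dir_deriv x (signed_perm_poly s e f) =
  signed_perm_poly s e (dir_deriv (signed_perm s e x) f).
Proof.
pose P f := dir_deriv x (signed_perm_poly s e f) =
  signed_perm_poly s e (dir_deriv (signed_perm s e x) f).
have PM g h : P g -> P h -> P (g * h).
  rewrite /P => Pg Ph.
  by rewrite !(dir_derivM, signed_perm_polyM, signed_perm_polyD) Pg Ph.
have PC c : P (mpolyC q c).
  by rewrite /P signed_perm_polyC !dir_derivC; exact/esym/comp_mpoly0.
elim/mpolyind: f => [|c m f _ _ Pf]; first exact: (PC 0).
rewrite !(dir_derivD, signed_perm_polyD) Pf; congr (_ + _).
rewrite !(dir_derivZ, signed_perm_polyZ); congr (_ *: _).
rewrite mpolyXE_id; apply: (big_ind P) => //; first exact: (PC 1).
move=> i _; elim: (m i) => [|n IH]; first by rewrite expr0; exact: (PC 1).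
rewrite exprS; apply: PM => //; rewrite /P signed_perm_polyXU dir_derivZ.
by rewrite !dir_derivXU signed_perm_polyC mxE -!alg_mpolyC scalerA.
Qed.

End WeylAction.

Section Weights.
Context {R : realType} {q : nat}.

Lemma bc_weight_proper d (p : R) (a : refl_index q) :
    d \in [:: 1; 2; 4]%N -> (1 <= q)%N -> 2 * q%:R - 1 < p ->
  proper_index a -> 0 < bc_weight d p a.
Proof.
move=> hd hq hp.
have d1 : 1 <= d%:R :> R by rewrite ler1n; move: hd; rewrite !inE => /or3P[] /eqP ->.
have q1 : 1 <= q%:R :> R by rewrite ler1n.
case: a => [i _|[[i j] b] /= ->]; last by rewrite /mult_hh; lra.
rewrite /= /mult_h /mult_2h divr_gt0// ltr_wpDr ?subr_ge0//.
by rewrite mulr_gt0//; lra.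
Qed.

Lemma bc_weight_improper d (p : R) (a : refl_index q) :
  ~~ proper_index a -> bc_weight d p a = 0.
Proof. by case: a => [//|[[i j] b] /= /negbTE ->]. Qed.

End Weights.

(** * The maximum principle on an orbit *)

Section MaximumPrinciple.
Context {R : realType} {q : nat}.
Implicit Types (x y : 'rV[R]_q) (f g : polyCq R q) (s : 'S_q)
  (e : {ffun 'I_q -> bool}).
Variables (d : nat) (p : R).
Hypothesis weight_gt0 :
  forall a : refl_index q, proper_index a -> 0 < bc_weight d p a.

Lemma refl_defectD (g h : 'rV[R]_q -> R) x : refl_defect d p (g \+ h) x =
  refl_defect d p g x + refl_defect d p h x.
Proof.
rewrite -big_split; apply: eq_bigr => a _ /=.
by rewrite -mulrDr opprD addrACA.
Qed.

Lemma refl_defectZ c (g : 'rV[R]_q -> R) x :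
  refl_defect d p (fun y => c * g y) x = c * refl_defect d p g x.
Proof.
by rewrite mulr_sumr; apply: eq_bigr => a _; rewrite -mulrBr mulrCA.
Qed.

Lemma refl_defect_ge0 (g : 'rV[R]_q -> R) x :
    (forall a, proper_index a -> g (root_refl (bc_root a) x) <= g x) ->
  0 <= refl_defect d p g x.
Proof.
move=> gx; rewrite sumr_ge0// => a _.
have [pa|npa] := boolP (proper_index a).
  by apply: mulr_ge0; [exact/ltW/weight_gt0 | rewrite subr_ge0 gx].
by rewrite bc_weight_improper// mul0r.
Qed.

(** At a point of the orbit where [`|g|] is maximal, [g] and its defect have the
    same sign, so that the defect can only increase the absolute value. *)
Lemma refl_defect_max (g : 'rV[R]_q -> R) x (n : R) B :
    0 <= n ->
    (forall s e, `|n * g (signed_perm s e x) +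
                   refl_defect d p g (signed_perm s e x)| <= B) ->
  forall s e, n * `|g (signed_perm s e x)| <= B.
Proof.
move=> n0 gB s e.
pose h (u : 'S_q * {ffun 'I_q -> bool}) := `|g (signed_perm u.1 u.2 x)|.
pose u0 : 'S_q * {ffun 'I_q -> bool} := (s, e).
case: (@Order.TotalTheory.arg_maxP _ _ _ u0 xpredT h erefl) => -[t c] _ hmax.
apply: le_trans (gB t c); apply: (@le_trans _ _ (n * h (t, c))).
  by rewrite ler_wpM2l//; exact: (hmax u0 isT).
rewrite /h /=; set y := signed_perm t c x.
have gy a : proper_index a -> `|g (root_refl (bc_root a) y)| <= `|g y|.
  move=> /(@root_refl_bc R)[t' [c' ->]]; rewrite /y signed_perm_comp.
  exact: (hmax ((t' * t)%g, [ffun i => c' i (+) c (t' i)]) isT).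
have [gy0|gy0] := leP 0 (g y).
  have dy : 0 <= refl_defect d p g y.
    apply: refl_defect_ge0 => a /gy; rewrite (ger0_norm gy0).
    exact: le_trans (ler_norm _).
  by rewrite (ger0_norm gy0) ger0_norm ?lerDl// addr_ge0// mulr_ge0.
have dy : refl_defect d p g y <= 0.
  rewrite -oppr_ge0 -mulN1r -refl_defectZ; apply: refl_defect_ge0 => a /gy.
  rewrite (ltr0_norm gy0) !mulN1r; apply: le_trans.
  by rewrite -normrN; exact: ler_norm.
rewrite (ltr0_norm gy0) ler0_norm; last first.
  by rewrite -[leRHS]addr0 lerD// mulr_ge0_le0// ltW.
by rewrite mulrN opprD lerDl oppr_ge0.
Qed.

End MaximumPrinciple.

(** * Consequences of the intertwining relation *)

Section Intertwiner.
Context {R : realType} {q : nat}.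
Implicit Types (x y : 'rV[R]_q) (f g : polyCq R q) (s : 'S_q)
  (e : {ffun 'I_q -> bool}).
Variables (d : nat) (p : R) (V : {linear polyCq R q -> polyCq R q}).
Hypothesis weight_gt0 :
  forall a : refl_index q, proper_index a -> 0 < bc_weight d p a.
Hypothesis V_intertwiner : is_dunkl_intertwiner d p V.

Lemma intertwiner_homog n f x : f \is ishomog1 n (@mdeg q) ->
  n%:R * (V f).@Cq[x] + refl_defect d p (fun y => (V f).@Cq[y]) x =
  (V (dir_deriv x f)).@Cq[x].
Proof.
case: V_intertwiner => Vh _ Vd fn.
rewrite -Vd dunkl_op_radial -euler_meval (euler_homog (Vh _ _ fn)).
by rewrite mevalZ.
Qed.

(** Without homogeneity the factor [n] becomes the Euler operator. *)
Lemma intertwiner_euler f x :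
  (V (euler f)).@Cq[x] + refl_defect d p (fun y => (V f).@Cq[y]) x =
  (V (dir_deriv x f)).@Cq[x].
Proof.
elim/mpolyind: f => [|c m f _ _ IH].
  have homog0 : (0 : polyCq R q) \is ishomog1 0 (@mdeg q) by exact: dhomog0.
  rewrite -(intertwiner_homog x homog0) mul0r (euler_homog homog0) scale0r.
  by rewrite linear0 meval0.
have Xm : mpolyX R m \is ishomog1 (mdeg m) (@mdeg q) by rewrite dhomogX.
rewrite eulerD dir_derivD eulerZ dir_derivZ !linearD !linearZ /=.
rewrite -IH -(intertwiner_homog x Xm) (euler_homog Xm) linearZ mevalZ mulrDr.
rewrite -refl_defectZ addrACA -refl_defectD; congr (_ + _).
by apply: eq_bigr => a _; rewrite /= !mevalD !mevalZ.
Qed.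

Lemma dir_deriv_root_exp x l n :
  dir_deriv x (root_poly l ^+ n.+1) =
  (n.+1%:R * root_app l x) *: root_poly l ^+ n.
Proof.
have d1 : dir_deriv x (root_poly l) = mpolyC q (root_app l x).
  have dd (I : Type) (r : seq I) (F : I -> polyCq R q) :
      dir_deriv x (\sum_(i <- r) F i) = \sum_(i <- r) dir_deriv x (F i).
    apply: big_morph; [exact: dir_derivD | exact: (dir_derivC x 0)].
  rewrite dd raddf_sum; apply: eq_bigr => i _.
  by rewrite dir_derivZ dir_derivXU -mul_mpolyC -mpolyCM.
elim: n => [|n IH]; first by rewrite expr1 d1 mul1r expr0 alg_mpolyC.
rewrite exprS dir_derivM IH d1 -scalerAr -exprS mul_mpolyC -scalerDl.
by congr (_ *: _); rewrite -[n.+2]add1n natrD mulrDl mul1r.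
Qed.

(** For [f = l ^ n] the Euler identity reads
    [n V (l ^ n) + defect = n l V (l ^ (n - 1))], and the maximum principle
    allows one to drop the defect. *)
Lemma intertwiner_moment_le l x (M : R) n :
    (forall s e, `|root_app l (signed_perm s e x)| <= M) ->
  forall s e, `|(V (root_poly l ^+ n)).@Cq[signed_perm s e x]| <= M ^+ n.
Proof.
move=> lM; elim: n => [|n IH] s e.
  by rewrite !expr0; case: V_intertwiner => _ -> _; rewrite meval1 normr1.
have n0 : 0 < n.+1%:R :> R by rewrite ltr0n.
rewrite -(ler_pM2l n0); move: s e.
apply: (refl_defect_max weight_gt0
  (g := fun y => (V (root_poly l ^+ n.+1)).@Cq[y]) (ltW n0)).
have ln : root_poly l ^+ n.+1 \is ishomog1 n.+1 (@mdeg q).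
  have l1 : root_poly l \is ishomog1 1 (@mdeg q).
    by rewrite rpred_sum// => i _; rewrite rpredZ// dhomogX /= mdeg1.
  by have := dhomogMn n.+1 l1; rewrite mul1n.
move=> s e; rewrite (intertwiner_homog _ ln).
rewrite dir_deriv_root_exp linearZ mevalZ !normrM (ger0_norm (ltW n0)).
by rewrite -mulrA exprS ler_wpM2l ?(ltW n0)// ler_pM.
Qed.

(** By induction on the degree, the two sides have the same directional
    derivatives after [V].  Their difference [b] then satisfies
    [n b + defect b = 0], and the maximum principle gives [b = 0]. *)
Lemma intertwiner_signed_perm_homog n f s e x : f \is ishomog1 n (@mdeg q) ->
  (V f).@Cq[signed_perm s e x] = (V (signed_perm_poly s e f)).@Cq[x].
Proof.
elim: n f x => [|n IH] f x fn.
  have [c ->] : exists c, f = mpolyC q c.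
    exists (mcoeff mnm0 f); apply/mpolyP => m; rewrite mcoeffC.
    have [<-|m0] := eqVneq mnm0 m; first by rewrite mulr1.
    rewrite mulr0; apply: (dhomog_nemf_coeff fn).
    by rewrite /= mdeg_eq0 eq_sym.
  rewrite signed_perm_polyC -alg_mpolyC linearZ.
  by case: V_intertwiner => _ -> _; rewrite !mevalZ !meval1.
pose b y := (V f).@Cq[signed_perm s e y] - (V (signed_perm_poly s e f)).@Cq[y].
have b0 y : n.+1%:R * b y + refl_defect d p b y = 0.
  have e1 := intertwiner_homog (signed_perm s e y) fn.
  have e2 := intertwiner_homog y (signed_perm_poly_homog s e fn).
  rewrite dir_deriv_signed_perm -(IH _ _ (dir_deriv_homog _ fn)) -e1 in e2.
  rewrite refl_defect_signed_perm in e2.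
  rewrite /b mulrBr.
  have -> : refl_defect d p b y =
    refl_defect d p ((fun y => (V f).@Cq[y]) \o signed_perm s e) y -
    refl_defect d p (fun y => (V (signed_perm_poly s e f)).@Cq[y]) y.
    rewrite -mulN1r -refl_defectZ -refl_defectD; apply: eq_bigr => a _.
    by rewrite /b /= !mulN1r.
  by rewrite addrACA -opprD e2 subrr.
have := @refl_defect_max _ _ _ _ weight_gt0 b x n.+1%:R 0 (ler0n _ _).
move=> /(_ _ 1%g [ffun=> false]); rewrite signed_perm1.
move=> H; apply/eqP; rewrite -subr_eq0 -normr_le0.
rewrite -(@ler_pM2l _ n.+1%:R) ?ltr0n// mulr0; apply: H => t c.
by rewrite b0 normr0.
Qed.

Lemma intertwiner_signed_perm f s e x :
  (V f).@Cq[signed_perm s e x] = (V (signed_perm_poly s e f)).@Cq[x].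
Proof.
elim/mpolyind: f => [|c m f _ _ IH].
  have homog0 : (0 : polyCq R q) \is ishomog1 0 (@mdeg q) by exact: dhomog0.
  exact: intertwiner_signed_perm_homog homog0.
have Xm : mpolyX R m \is ishomog1 (mdeg m) (@mdeg q) by rewrite dhomogX.
rewrite signed_perm_polyD signed_perm_polyZ !linearD !linearZ /=.
rewrite IH.
by rewrite (intertwiner_signed_perm_homog _ _ _ Xm).
Qed.

End Intertwiner.

(** * Integrals of polynomials *)

Section PolynomialIntegrals.
Context {R : realType} {q : nat}.
Implicit Types (x y : 'rV[R]_q) (f g : polyCq R q).

Lemma open_measurable_Cq (U : set 'rV[R]_q) :
  open U -> measurable (U : set (borelCq R q)).
Proof. by move=> oU; exact: sub_sigma_algebra. Qed.

Lemma continuous_measurable_Cq (g : 'rV[R]_q -> R) :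
  continuous g -> measurable_fun setT (g : borelCq R q -> R).
Proof.
move=> /continuousP cg.
apply: (measurability _ (RGenOpens.measurableE R)).
move=> _ [_ [a [b ->] <-]]; rewrite setTI; apply: open_measurable_Cq.
exact/cg/interval_open.
Qed.

Lemma meval_continuous f : continuous (fun x : 'rV[R]_q => f.@Cq[x]).
Proof.
pose P (f : polyCq R q) := continuous (fun x : 'rV[R]_q => f.@Cq[x]).
have PM g h : P g -> P h -> P (g * h).
  move=> cg ch x; rewrite (_ : (fun _ => _) =
      (fun y => g.@Cq[y]) \* (fun y => h.@Cq[y])); last first.
    by apply/funext => y; rewrite mevalM.
  by apply: continuousM; [exact: cg | exact: ch].
have PD g h : P g -> P h -> P (g + h).
  move=> cg ch x; rewrite (_ : (fun _ => _) =
      (fun y => g.@Cq[y]) + (fun y => h.@Cq[y])); last first.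
    by apply/funext => y; rewrite mevalD.
  by apply: continuousD; [exact: cg | exact: ch].
have PC c : P (mpolyC q c).
  rewrite /P (_ : (fun _ => _) = cst c); first by move=> x; exact: cst_continuous.
  by apply/funext => y; rewrite mevalC.
change (P f); elim/mpolyind: f => [|c m f _ _ IH]; first exact: (PC 0).
apply: (PD); last exact: IH.
rewrite -mul_mpolyC; apply: (PM); first exact: PC.
rewrite mpolyXE_id; apply: (big_ind P); [exact: (PC 1) | exact: PM | move=> i _].
elim: (m i) => [|n IHn]; first by rewrite expr0; exact: (PC 1).
rewrite exprS; apply: (PM); last exact: IHn.
move=> x.
rewrite (_ : (fun _ => _) = (fun y : 'rV[R]_q => y 0 i)); last first.
  by apply/funext => y; rewrite mevalXU.
exact: coord_continuous.
Qed.

Lemma meval_measurable f (D : set (borelCq R q)) :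
  measurable_fun D (EFin \o (fun H : borelCq R q => f.@Cq[(H : 'rV[R]_q)] : R)).
Proof.
apply/measurable_EFinP; apply: (@measurable_funS _ _ _ _ setT) => //.
by have := continuous_measurable_Cq (@meval_continuous f).
Qed.

Variable mu : probability (borelCq R q) R.

Lemma le_measure_integral (A : set 'rV[R]_q) f (c : R) :
    measurable (A : set (borelCq R q)) -> 0 <= c ->
    (forall x, 0 <= f.@Cq[x]) -> (forall x, A x -> c <= f.@Cq[x]) ->
  (c%:E * mu A <= \int[mu]_H (f.@Cq[(H : 'rV[R]_q)])%:E)%E.
Proof.
move=> mA c0 f0 fA; rewrite -(integral_cst mu mA).
apply: (@le_trans _ _ (\int[mu]_(H in (A : set (borelCq R q)))
    (f.@Cq[(H : 'rV[R]_q)])%:E)%E).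
  apply: ge0_le_integral => //; exact: meval_measurable.
apply: ge0_subset_integral => //; first exact: meval_measurable.
by move=> H _; rewrite lee_fin.
Qed.

Lemma integral_le_bound (N : set 'rV[R]_q) f (c : R) :
    mu.-negligible N -> 0 <= c ->
    (forall x, 0 <= f.@Cq[x]) -> (forall x, ~ N x -> f.@Cq[x] <= c) ->
  (\int[mu]_H (f.@Cq[(H : 'rV[R]_q)])%:E <= c%:E)%E.
Proof.
move=> N0 c0 f0 fN.
have -> : c%:E = (\int[mu]_H (cst c%:E) H)%E.
  rewrite integral_cst// -[LHS]mule1; congr (_ * _)%E.
  exact/esym/probability_setT.
apply: ae_ge0_le_integral => //.
- by move=> H _; rewrite lee_fin.
- exact: meval_measurable.
- apply: negligibleS N0 => H /= NH; apply: contrapT => nNH.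
  by apply: NH => _; rewrite lee_fin fN.
Qed.

End PolynomialIntegrals.

(** * Polynomials along a segment *)

Section LinePolynomials.
Context {R : realType} {q : nat}.
Implicit Types (x y : 'rV[R]_q) (f g : polyCq R q).

(** The polynomial [y |-> f ((1 - s) x + s y)]. *)
Definition line_poly x (s : R) f : polyCq R q :=
  comp_mpoly [tuple mpolyC q ((1 - s) * x 0 i) + s *: polyCqX i | i < q] f.

Lemma line_polyE x s f y :
  (line_poly x s f).@Cq[y] = f.@Cq[(1 - s) *: x + s *: y].
Proof.
rewrite /line_poly comp_mpoly_meval; apply: meval_eq => i.
by rewrite tnth_mktuple mevalD mevalC mevalZ mevalXU !mxE.
Qed.

Lemma line_polyXU x s i : line_poly x s (polyCqX i) =
  mpolyC q ((1 - s) * x 0 i) + s *: polyCqX i.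
Proof. by rewrite /line_poly comp_mpolyXU -tnth_nth tnth_mktuple. Qed.

(** Along the segment from [x] to the variable point, [s d/ds] acts as the
    Euler operator minus the derivative in the direction [x]: both sides are
    derivations and they agree on the coordinates. *)
Lemma line_poly_curve x f : exists F : {poly polyCq R q}, forall s,
  F.[mpolyC q s] = line_poly x s f /\
  s *: F^`().[mpolyC q s] =
    euler (line_poly x s f) - dir_deriv x (line_poly x s f).
Proof.
pose P f := exists F : {poly polyCq R q}, forall s,
  F.[mpolyC q s] = line_poly x s f /\
  s *: F^`().[mpolyC q s] =
    euler (line_poly x s f) - dir_deriv x (line_poly x s f).
have PC c : P (mpolyC q c).
  exists (mpolyC q c)%:P => s; rewrite hornerC derivC horner0 scaler0.
  by rewrite /line_poly comp_mpolyC eulerC dir_derivC subrr.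
have PD g h : P g -> P h -> P (g + h).
  move=> [F FE] [G GE]; exists (F + G) => s.
  have [F0 F1] := FE s; have [G0 G1] := GE s.
  have lD : line_poly x s (g + h) = line_poly x s g + line_poly x s h.
    exact: comp_mpolyD.
  rewrite derivD !hornerD F0 G0 scalerDr F1 G1 lD; split=> //.
  by rewrite eulerD dir_derivD opprD addrACA.
have PM g h : P g -> P h -> P (g * h).
  move=> [F FE] [G GE]; exists (F * G) => s.
  have [F0 F1] := FE s; have [G0 G1] := GE s.
  have lM : line_poly x s (g * h) = line_poly x s g * line_poly x s h.
    exact: rmorphM.
  rewrite derivM hornerD !hornerM F0 G0 scalerDr scalerAl F1 scalerAr G1 lM.
  split=> //; rewrite eulerM dir_derivM.
  set a := euler _; set b := dir_deriv _ _; set a' := euler _.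
  by set b' := dir_deriv _ _; ring.
change (P f); elim/mpolyind: f => [|c m f _ _ IH]; first exact: (PC 0).
apply: (PD); last exact: IH.
rewrite -mul_mpolyC; apply: (PM); first exact: PC.
rewrite mpolyXE_id; apply: (big_ind P); [exact: (PC 1) | exact: PM | move=> i _].
elim: (m i) => [|n IHn]; first by rewrite expr0; exact: (PC 1).
rewrite exprS; apply: (PM); last exact: IHn.
exists ((mpolyC q (x 0 i))%:P * (1%:P - 'X) + (polyCqX i)%:P * 'X) => s.
rewrite derivD !derivM derivB derivX !derivC.
rewrite !(hornerD, hornerM, hornerN, hornerC, hornerX) line_polyXU.
rewrite eulerD eulerC eulerZ eulerXU dir_derivD dir_derivC dir_derivZ dir_derivXU.
rewrite -!mul_mpolyC !mpolyCM mpolyCB -[mpolyC q 1]/(1 : polyCq R q).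
by split; ring.
Qed.

End LinePolynomials.

(** * The first jump *)

Section FirstJump.
Context {R : realType} {q : nat}.
Implicit Types (x y : 'rV[R]_q) (f g : polyCq R q).
Variables (d : nat) (p : R) (V : {linear polyCq R q -> polyCq R q}).
Hypothesis weight_gt0 :
  forall a : refl_index q, proper_index a -> 0 < bc_weight d p a.
Hypothesis V_intertwiner : is_dunkl_intertwiner d p V.
Variables (X : 'rV[R]_q) (mu : probability (borelCq R q) R).
Hypothesis mu_V : represents V X mu.

Lemma bc_weight_ge0 (a : refl_index q) : 0 <= bc_weight d p a.
Proof.
have [pa|npa] := boolP (proper_index a); first exact/ltW/weight_gt0.
by rewrite bc_weight_improper.
Qed.

Lemma represents_ge (A : set 'rV[R]_q) f (c : R) :
    measurable (A : set (borelCq R q)) -> 0 <= c ->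
    (forall x, 0 <= f.@Cq[x]) -> (forall x, A x -> c <= f.@Cq[x]) ->
  c * fine (mu A) <= (V f).@Cq[X].
Proof.
move=> mA c0 f0 fA; have := le_measure_integral mu mA c0 f0 fA.
by rewrite -mu_V -(fineK (fin_num_measure mu _ mA)) -EFinM lee_fin.
Qed.

Lemma represents_le (N : set 'rV[R]_q) f (c : R) :
    mu.-negligible (N : set (borelCq R q)) -> 0 <= c ->
    (forall x, 0 <= f.@Cq[x]) -> (forall x, ~ N x -> f.@Cq[x] <= c) ->
  (V f).@Cq[X] <= c.
Proof.
move=> N0 c0 f0 fN; have := integral_le_bound N0 c0 f0 fN.
by rewrite -mu_V lee_fin.
Qed.

Lemma represents_ge0 f : (forall x, 0 <= f.@Cq[x]) -> 0 <= (V f).@Cq[X].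
Proof.
move=> f0; have := @represents_ge set0 f 0 measurable0 (lexx 0) f0.
by rewrite mul0r; apply.
Qed.

(** The measure that represents [V] at [X] also represents it at [r X], after
    transport by [r]. *)
Lemma represents_refl_ge a (A : set 'rV[R]_q) f (c : R) :
    proper_index a -> measurable (A : set (borelCq R q)) -> 0 <= c ->
    (forall x, 0 <= f.@Cq[x]) ->
    (forall x, A x -> c <= f.@Cq[root_refl (bc_root a) x]) ->
  c * fine (mu A) <= (V f).@Cq[root_refl (bc_root a) X].
Proof.
move=> pa mA c0 f0 fA; have [s [e ae]] := @root_refl_bc R _ _ pa.
rewrite ae (intertwiner_signed_perm weight_gt0 V_intertwiner).
by apply: represents_ge => // x; rewrite signed_perm_polyE// => /fA; rewrite ae.
Qed.

Lemma represents_refl_ge0 a f : proper_index a ->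
  (forall x, 0 <= f.@Cq[x]) -> 0 <= (V f).@Cq[root_refl (bc_root a) X].
Proof.
move=> pa f0.
have := @represents_refl_ge a set0 f 0 pa measurable0 (lexx 0) f0.
by rewrite mul0r; apply.
Qed.

(** The differential equation for [s |-> (V f_s)(X)], which is a polynomial in
    [s] because [V] is linear. *)
Lemma first_jump_equation f : exists h : {poly R}, forall s,
  h.[s] = (V (line_poly X s f)).@Cq[X] /\
  s * h^`().[s] +
    refl_defect d p (fun y => (V (line_poly X s f)).@Cq[y]) X = 0.
Proof.
have [F FE] := line_poly_curve X f.
pose L g := (V g).@Cq[X].
have L0 : L 0 = 0 by rewrite /L linear0 meval0.
have LZ c g : L (c *: g) = c * L g by rewrite /L linearZ mevalZ.
have LD g h : L (g + h) = L g + L h by rewrite /L linearD mevalD.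
have LE (G : {poly polyCq R q}) s : (map_poly L G).[s] = L G.[mpolyC q s].
  rewrite horner_poly horner_coef (big_morph L LD L0).
  apply: eq_bigr => i _.
  have -> : mpolyC q s ^+ i = mpolyC q (s ^+ i) by rewrite rmorphXn.
  by rewrite mulrC [G`_i * _]mulrC mul_mpolyC LZ.
have Ld (G : {poly polyCq R q}) : (map_poly L G)^`() = map_poly L G^`().
  apply/polyP => i; rewrite coef_deriv !coef_map_id0// coef_deriv.
  by rewrite /L linearMn mevalMn.
exists (map_poly L F) => s; have [F0 F1] := FE s.
rewrite Ld !LE F0 -LZ F1; split=> //.
have := intertwiner_euler V_intertwiner (line_poly X s f) X.
by rewrite /L linearB mevalB => <-; ring.
Qed.

(** Conditioning on the first jump: with [f_s H = f ((1 - s) X + s H)] and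
    [gam] the sum of the weights [k_r], the function [h s = (V f_s)(X)] satisfies
    [(s ^ gam h)' = s ^ (gam - 1) (sum_r k_r (V f_s)(r X))].  So [(V f)(X) = h 1]
    is an average of the values [(V f_s)(r X)] over the time [s] of the jump and
    the reflection [r], and the mass that [mu] gives to a set [A] reappears on
    [(1 - s) X + s (r A)].  The constant [k] does not depend on [f], which is
    what makes it possible to let [f] vary afterwards. *)
Lemma first_jump_ge a (A : set 'rV[R]_q) (s1 s2 : R) :
    proper_index a -> measurable (A : set (borelCq R q)) -> (0 < mu A)%E ->
    0 < s1 -> s1 < s2 -> s2 <= 1 ->
  exists2 k : R, 0 < k & forall f (c : R), 0 <= c ->
    (forall x, 0 <= f.@Cq[x]) ->
    (forall s H, s1 <= s <= s2 -> A H ->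
      c <= f.@Cq[(1 - s) *: X + s *: root_refl (bc_root a) H]) ->
  k * c <= (V f).@Cq[X].
Proof.
move=> pa mA A0 s10 s12 s21.
pose w := bc_weight d p a * fine (mu A).
have w0 : 0 < w.
  by rewrite mulr_gt0 ?weight_gt0// fine_gt0// A0 ltey_eq fin_num_measure.
pose gam := \sum_(b : refl_index q) bc_weight d p b.
(* For f >= 0 the real exponent gam can be replaced by any larger integer, at
   the price of an inequality; then only derivatives of polynomials occur. *)
have [N gamN] : exists N : nat, gam <= N.+1%:R.
  have gam0 : 0 <= gam by rewrite sumr_ge0// => b _; exact: bc_weight_ge0.
  exists (Num.bound gam); apply/ltW/(lt_le_trans (archi_boundP gam0)).
  by rewrite ler_nat.
exists ((s2 - s1) * (s1 ^+ N * w)).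
  by apply: mulr_gt0; [rewrite subr_gt0 | apply: mulr_gt0 => //; exact: exprn_gt0].
move=> f c c0 f0 fA.
have [h hE] := first_jump_equation f.
have fs0 s y : 0 <= (line_poly X s f).@Cq[y] by rewrite line_polyE.
have h0 (s : R) : 0 <= h.[s] by rewrite (hE s).1 represents_ge0.
pose B s := \sum_b bc_weight d p b *
  (V (line_poly X s f)).@Cq[root_refl (bc_root b) X].
have Bterm s b : 0 <= bc_weight d p b *
    (V (line_poly X s f)).@Cq[root_refl (bc_root b) X].
  have [pb|npb] := boolP (proper_index b); last first.
    by rewrite bc_weight_improper// mul0r.
  by rewrite mulr_ge0 ?bc_weight_ge0// represents_refl_ge0.
have B0 s : 0 <= B s by rewrite sumr_ge0.
have BA s : s1 <= s <= s2 -> w * c <= B s.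
  move=> s12s; rewrite /B (bigD1 a)//= -[leLHS]addr0 lerD ?sumr_ge0// -mulrA.
  rewrite ler_wpM2l ?bc_weight_ge0// mulrC represents_refl_ge// => H AH.
  by rewrite line_polyE fA.
have h1 s : s * h^`().[s] = B s - gam * h.[s].
  have [hs /eqP] := hE s; rewrite addr_eq0 => /eqP ->.
  rewrite /refl_defect /B /gam hs mulr_suml -sumrB -sumrN.
  by apply: eq_bigr => b _; rewrite mulrBr opprB.
pose k : {poly R} := 'X^(N.+1) * h.
have kE s : k.[s] = s ^+ N.+1 * h.[s] by rewrite hornerM hornerXn.
have k1 (s : R) : k^`().[s] = s ^+ N * ((N.+1%:R - gam) * h.[s] + B s).
  rewrite derivM derivXn /= hornerD !hornerM hornerMn !hornerXn exprSr -[s ^+ N * s * _]mulrA.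
  rewrite h1 -mulr_natr; move: (N.+1%:R : R) (s ^+ N) (h.[s]) (B s) => t1 t2 t3 t4.
  by ring.
have s20 : 0 < s2 := lt_trans s10 s12.
have k10 (s : R) : 0 <= s -> 0 <= k^`().[s].
  by move=> s0; rewrite k1 mulr_ge0 ?exprn_ge0// addr_ge0// mulr_ge0// subr_ge0.
have k2_1 : k.[s2] <= k.[1].
  move: s21; rewrite le_eqVlt => /predU1P[->//|s21].
  have [t + kt] := polyrcf.poly_mvt k s21.
  rewrite in_itv /= => /andP[s2t _]; rewrite -subr_ge0 kt.
  by rewrite mulr_ge0 ?subr_ge0 ?(ltW s21)// k10// ltW// (lt_trans s20).
have k12 : (s2 - s1) * (s1 ^+ N * w * c) <= k.[s2] - k.[s1].
  have [t + ->] := polyrcf.poly_mvt k s12.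
  rewrite in_itv /= => /andP[s1t s2t]; rewrite mulrC ler_wpM2r ?subr_ge0 ?(ltW s12)//.
  rewrite k1 -[leLHS]mulrA; apply: ler_pM.
  - exact/exprn_ge0/ltW.
  - by rewrite mulr_ge0 ?(ltW w0).
  - by rewrite lerXn2r ?nnegrE ?(ltW s10) ?(ltW s1t)// ltW// (lt_trans s10).
  - apply: le_trans (BA t _) _; first by rewrite !ltW.
    by rewrite lerDr mulr_ge0// subr_ge0.
have k1E : k.[1] = (V f).@Cq[X].
  rewrite kE expr1n mul1r (hE 1).1; congr (V _).@Cq[X].
  rewrite -[RHS]comp_mpoly_id; congr comp_mpoly; apply: eq_from_tnth => i.
  by rewrite !tnth_mktuple subrr mul0r mpolyC0 add0r scale1r.
rewrite -k1E -mulrA; apply: le_trans k12 (le_trans _ k2_1).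
by rewrite gerBl kE mulr_ge0// exprn_ge0// ltW.
Qed.

End FirstJump.

(** * The support *)

Lemma geometric_lt (R : realType) (a b k : R) :
  0 <= b < a -> (forall n, k * a ^+ n <= b ^+ n) -> k <= 0.
Proof.
move=> /andP[b0 ba] kab; rewrite leNgt; apply/negP => k0.
have a0 : 0 < a := le_lt_trans b0 ba.
have r1 : `|b / a| < 1.
  by rewrite ger0_norm ?divr_ge0 ?(ltW a0)// ltr_pdivrMr// mul1r.
have /cvgr0Pnorm_lt/(_ k k0)[n _ /(_ n (leqnn n))] := cvg_expr r1.
rewrite /= ltNge ger0_norm; last by rewrite exprn_ge0// divr_ge0// ltW.
by rewrite expr_div_n ler_pdivlMr ?exprn_gt0// kab.
Qed.

Section Support.
Context {R : realType} {q : nat}.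
Implicit Types (x y : 'rV[R]_q) (f g : polyCq R q).
Variables (d : nat) (p : R) (V : {linear polyCq R q -> polyCq R q}).
Hypothesis weight_gt0 :
  forall a : refl_index q, proper_index a -> 0 < bc_weight d p a.
Hypothesis V_intertwiner : is_dunkl_intertwiner d p V.
Variables (X : 'rV[R]_q) (mu : probability (borelCq R q) R).
Hypothesis mu_V : represents V X mu.

Lemma meval_gt_open f (c : R) : open [set x : 'rV[R]_q | c < f.@Cq[x]].
Proof.
by have /continuousP/(_ _ (@open_gt R c)) := @meval_continuous R q f.
Qed.

(** By Chebyshev's inequality the mass of this set is at most
    [(M ^ 2 / c) ^ n] for all [n]. *)
Lemma tail_negligible l (M c : R) :
    (forall s e, `|root_app l (signed_perm s e X)| <= M) -> M ^+ 2 < c ->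
  mu.-negligible [set x | c < (root_poly l ^+ 2).@Cq[x]].
Proof.
move=> lM Mc; set A := [set x | _].
have mA : measurable (A : set (borelCq R q)).
  by apply: open_measurable_Cq; exact: meval_gt_open.
apply/negligibleP => //.
have M2 : 0 <= M ^+ 2 by exact: sqr_ge0.
have even_pow n x : (root_poly l ^+ (2 * n)).@Cq[x] = (root_app l x ^+ 2) ^+ n.
  by rewrite rmorphXn /= root_polyE exprM.
have : fine (mu A) <= 0.
  apply: (@geometric_lt _ c (M ^+ 2)) => [|n]; first by rewrite M2.
  rewrite mulrC -exprM.
  apply: (@le_trans _ _ (V (root_poly l ^+ (2 * n))).@Cq[X]).
    apply: (represents_ge mu_V) => //.
    - by rewrite exprn_ge0// ltW// (le_lt_trans M2).
    - by move=> x; rewrite even_pow exprn_ge0// sqr_ge0.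
    - move=> x /=; rewrite /A /= even_pow rmorphXn /= root_polyE => cx.
      by rewrite lerXn2r ?nnegrE ?sqr_ge0 ?ltW// (le_lt_trans M2).
  have := intertwiner_moment_le weight_gt0 V_intertwiner (2 * n) lM 1%g [ffun=> false].
  rewrite signed_perm1; exact/le_trans/ler_norm.
move=> A0; rewrite -(fineK (fin_num_measure mu _ mA)).
by apply/eqP; rewrite eqe eq_le A0 fine_ge0.
Qed.

Definition dist2_poly y : polyCq R q :=
  \sum_i (polyCqX i - mpolyC q (y 0 i)) ^+ 2.

Lemma dist2_polyE y x : (dist2_poly y).@Cq[x] = \sum_i (x 0 i - y 0 i) ^+ 2.
Proof.
rewrite meval_sum; apply: eq_bigr => i _.
by rewrite rmorphXn /= mevalB mevalXU mevalC.
Qed.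

Lemma dist2_lt_coord x y (eps : R) i : 0 <= eps ->
  (dist2_poly y).@Cq[x] < eps ^+ 2 -> `|x 0 i - y 0 i| < eps.
Proof.
move=> eps0 xeps; rewrite -(@ltr_pXn2r _ 2) ?nnegrE// real_normK ?num_real//.
apply: le_lt_trans xeps; rewrite dist2_polyE (bigD1 i)//= lerDl sumr_ge0// => j _.
exact: sqr_ge0.
Qed.

Lemma coord_le_norm1 x i : `|x 0 i| <= \sum_j `|x 0 j|.
Proof. by rewrite (bigD1 i)//= lerDl sumr_ge0. Qed.

Lemma coord_tail_negligible i :
  mu.-negligible [set x | (\sum_j `|X 0 j| + 1) ^+ 2 <
                          (root_poly (root_h i) ^+ 2).@Cq[x]].
Proof.
apply: (@tail_negligible _ (\sum_j `|X 0 j|)) => [s e|].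
  rewrite root_app_h mxE normrM normrX normrN1 expr1n mul1r.
  exact: coord_le_norm1.
rewrite ltr_pXn2r ?nnegrE ?addr_ge0 ?sumr_ge0// ltrDl//.
Qed.

(** The measure lives on a bounded set, which keeps the bump polynomials below
    between [0] and [1] almost everywhere. *)
Lemma dist2_bounded y : exists2 K : R, 0 <= K &
  mu.-negligible [set x | K < (dist2_poly y).@Cq[x]].
Proof.
pose L : R := \sum_j `|X 0 j| + 1; have L0 : 0 <= L by rewrite addr_ge0 ?sumr_ge0.
exists (\sum_i (L + `|y 0 i|) ^+ 2); first by rewrite sumr_ge0// => i _; exact: sqr_ge0.
apply: (@negligibleS _ _ _ mu (\big[setU/set0]_(i < q)
    [set x | L ^+ 2 < (root_poly (root_h i) ^+ 2).@Cq[x]])); last first.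
  elim/big_ind: _ => [|A B|i _]; [exact: negligible_set0|exact: negligibleU|].
  exact: coord_tail_negligible.
move=> x /=; rewrite dist2_polyE => Lx; apply: contrapT => xN.
suff : \sum_i (x 0 i - y 0 i) ^+ 2 <= \sum_i (L + `|y 0 i|) ^+ 2.
  by rewrite leNgt Lx.
apply: ler_sum => i _; rewrite -[leLHS]real_normK ?num_real//.
rewrite ler_pXn2r ?nnegrE ?(addr_ge0 L0)//; apply: (le_trans (ler_normB _ _)).
rewrite lerD2r leNgt; apply/negP => Lxi; apply: xN.
rewrite (bigD1 i)//=; left; rewrite /= rmorphXn /= root_polyE root_app_h.
by rewrite -[ltRHS]real_normK ?num_real// ltr_pXn2r ?nnegrE.
Qed.

(** A point is in the support as soon as the mass carried to each of its
    neighbourhoods by a first jump is positive.  If a neighbourhood [U] of [y]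
    were null, the polynomials [(1 - |H - y|^2 / K) ^ (2 n)], which decay
    outside [U] faster than near [y], would violate the lower bound. *)
Lemma support_first_jump y :
    (forall eps : R, 0 < eps -> exists a (A : set 'rV[R]_q) s1 s2,
      [/\ proper_index a, open A & (0 < mu A)%E] /\
      [/\ 0 < s1, s1 < s2, s2 <= 1 & forall s H i, s1 <= s <= s2 -> A H ->
        `|((1 - s) *: X + s *: root_refl (bc_root a) H) 0 i - y 0 i| <= eps]) ->
  measure_support (mu : set 'rV[R]_q -> \bar R) y.
Proof.
move=> near_y U oU Uy; rewrite lt0e measure_ge0 andbT; apply/eqP => U0.
have [eps eps0 epsU] : exists2 eps : R, 0 < eps &
    forall x, (forall i, `|x 0 i - y 0 i| < eps) -> U x.
  have /nbhs_ballP[eps eps0 epsU] := open_nbhs_nbhs (conj oU Uy).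
  exists eps => // x xy; apply: epsU; split=> // i j.
  by rewrite (ord1 i) -ball_normE /= distrC.
have [K K0 tailK] := dist2_bounded y.
(* eta is small enough for the cube of half-side eta to lie well inside the
   Euclidean ball of radius eps, which is contained in U *)
pose eta := eps / (2 * (q%:R + 1)).
have q0 : 0 <= q%:R :> R by [].
have eta0 : 0 < eta by rewrite divr_gt0// mulr_gt0// ltr_wpDl.
have [a [A [s1 [s2 [[pa oA A0] [s10 s12 s21 jump]]]]]] := near_y _ eta0.
have [k k0 klow] := first_jump_ge weight_gt0 V_intertwiner mu_V pa
  (open_measurable_Cq oA) A0 s10 s12 s21.
pose K1 := K + eps ^+ 2.
have K10 : 0 < K1 by rewrite ltr_wpDl// exprn_gt0.
pose bump n : polyCq R q := (1 - K1^-1 *: dist2_poly y) ^+ (2 * n).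
have bumpE n x : (bump n).@Cq[x] = (1 - (dist2_poly y).@Cq[x] / K1) ^+ (2 * n).
  by rewrite rmorphXn /= mevalB meval1 mevalZ mulrC.
have bump0 n x : 0 <= (bump n).@Cq[x] by rewrite bumpE exprM exprn_ge0// sqr_ge0.
pose far := 1 - eps ^+ 2 / K1; pose close := 1 - q%:R * eta ^+ 2 / K1.
have far0 : 0 <= far by rewrite subr_ge0 ler_pdivrMr// mul1r lerDr.
have far_close : far < close.
  rewrite ltrD2l ltrN2 ltr_pM2r ?invr_gt0// /eta expr_div_n mulrA.
  rewrite ltr_pdivrMr ?exprn_gt0 ?mulr_gt0 ?ltr_wpDl// mulrC ltr_pM2l ?exprn_gt0//.
  by nra.
have close0 : 0 < close := le_lt_trans far0 far_close.
have : k <= 0; last by rewrite leNgt k0.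
apply: (@geometric_lt _ (close ^+ 2) (far ^+ 2)) => [|n].
  by rewrite sqr_ge0 ltr_pXn2r ?nnegrE ?(ltW close0).
apply: (@le_trans _ _ (V (bump n)).@Cq[X]).
  apply: klow => //; first by rewrite exprn_ge0// sqr_ge0.
  move=> s H s12s AH; rewrite bumpE -exprM.
  set D := meval _ _; have closeD : close <= 1 - D / K1.
    rewrite lerD2l lerN2 ler_pM2r ?invr_gt0// /D dist2_polyE.
    rewrite -[q in q%:R]card_ord mulr_natl -sumr_const; apply: ler_sum => i _.
    rewrite -[leLHS]real_normK ?num_real// ler_pXn2r ?nnegrE ?(ltW eta0)//.
    exact: jump.
  by rewrite lerXn2r ?nnegrE ?(ltW close0)// (le_trans (ltW close0)).
rewrite -exprM.
apply: (represents_le mu_V (N := U `|` [set x | K < (dist2_poly y).@Cq[x]])) => //.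
- apply: negligibleU => //; apply/negligibleP => //; exact: open_measurable_Cq.
- by rewrite exprn_ge0.
move=> x /not_orP[nUx /negP]; rewrite -leNgt => xK; rewrite bumpE.
have epsx : eps ^+ 2 <= (dist2_poly y).@Cq[x].
  rewrite leNgt; apply/negP => xeps; apply/nUx/epsU => i.
  exact: dist2_lt_coord (ltW eps0) xeps.
rewrite lerXn2r ?nnegrE//.
  rewrite subr_ge0 ler_pdivrMr// mul1r (le_trans xK)// lerDl.
  exact: sqr_ge0.
by rewrite lerD2l lerN2 ler_pM2r ?invr_gt0.
Qed.

Hypothesis q_gt0 : (0 < q)%N.

Lemma root_refl_coord a i : proper_index a -> exists j (c : R),
  `|c| = 1 /\ forall x, root_refl (bc_root a) x 0 i = c * x 0 j.
Proof.
move=> /(@root_refl_bc R)[s [e ae]]; exists (s i), ((-1) ^+ e i).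
by split=> [|x]; [rewrite normrX normrN1 expr1n | rewrite ae mxE].
Qed.

Lemma segmentE (s : R) x y i :
  ((1 - s) *: x + s *: y) 0 i = (1 - s) * x 0 i + s * y 0 i.
Proof. by rewrite !mxE. Qed.

(** The first jump may occur at a time [s] close to [0], when the point
    [(1 - s) X + s (r H)] is close to [X], uniformly for [H] in a bounded set. *)
Lemma support_basepoint : measure_support (mu : set 'rV[R]_q -> \bar R) X.
Proof.
apply: support_first_jump => eps eps0.
have [K K0 tailK] := dist2_bounded 0.
pose L : R := \sum_j `|X 0 j|; have L0 : 0 <= L by rewrite sumr_ge0.
have K10 : 0 < K + 1 by rewrite ltr_wpDl.
pose A := [set x : 'rV[R]_q | (dist2_poly 0).@Cq[x] < (K + 1) ^+ 2].
have oA : open A.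
  by have /continuousP/(_ _ (@open_lt R ((K + 1) ^+ 2))) := @meval_continuous R q (dist2_poly 0).
pose C := L + (K + 1); have C0 : 0 < C by rewrite ltr_wpDl// ltr_wpDl.
pose t := Num.min 1 (eps / C).
have t0 : 0 < t by rewrite lt_min ltr01 divr_gt0.
pose a : refl_index q := inl (Ordinal q_gt0); have pa : proper_index a by [].
exists a, A, (t / 2), t; split.
  split=> //; rewrite lt0e measure_ge0 andbT; apply/eqP => A0.
  have : mu.-negligible (setT : set (borelCq R q)).
    have nA : mu.-negligible (A : set (borelCq R q)).
      by apply/negligibleP => //; exact: open_measurable_Cq.
    apply: negligibleS (negligibleU tailK nA) => x _.
    have [xK|xK] := ltP K (dist2_poly 0).@Cq[x];
      [by left | right; rewrite /A /= (le_lt_trans xK)// expr2; nra].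
  move=> /negligibleP => /(_ measurableT) mu0.
  have /eqP : 0%E = 1%E :> \bar R by rewrite -mu0; exact: probability_setT.
  by rewrite eqe eq_sym oner_eq0.
split; [by rewrite divr_gt0|lra|by rewrite ge_min lexx|].
move=> s H i /andP[ts st] AH.
have s0 : 0 <= s by apply: le_trans ts; rewrite divr_ge0// ltW.
have [j [c [c1 rE]]] := root_refl_coord i pa.
rewrite segmentE rE (_ : _ - _ = s * (c * H 0 j - X 0 i)); last by ring.
rewrite normrM (ger0_norm s0); apply: (@le_trans _ _ (t * C)).
  apply: ler_pM => //; apply: le_trans (ler_normB _ _) _.
  rewrite normrM c1 mul1r addrC lerD ?coord_le_norm1//.
  have := dist2_lt_coord j (ltW K10) AH.
  by rewrite mxE subr0 => /ltW.
by rewrite -ler_pdivlMr// ge_min lexx orbT.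
Qed.

Lemma support_step y a (s0 : R) : proper_index a -> 0 <= s0 <= 1 ->
    measure_support (mu : set 'rV[R]_q -> \bar R) y ->
  measure_support (mu : set 'rV[R]_q -> \bar R)
    ((1 - s0) *: X + s0 *: root_refl (bc_root a) y).
Proof.
move=> pa /andP[s00 s01] Sy; apply: support_first_jump => eps eps0.
pose C : R := \sum_j `|X 0 j| + \sum_j `|y 0 j| + 1.
have C0 : 0 < C by rewrite ltr_wpDl// addr_ge0 ?sumr_ge0.
pose t := Num.min 1 (eps / 2 / C).
have t0 : 0 < t by rewrite lt_min ltr01 divr_gt0// divr_gt0.
have t1 : t <= 1 by rewrite ge_min lexx.
have tC : t * C <= eps / 2 by rewrite -ler_pdivlMr// ge_min lexx orbT.
pose A := [set x : 'rV[R]_q | (dist2_poly y).@Cq[x] < (eps / 2) ^+ 2].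
have oA : open A.
  have /continuousP/(_ _ (@open_lt R ((eps / 2) ^+ 2))) := @meval_continuous R q (dist2_poly y).
  by [].
have Ay : A y.
  rewrite /A /= dist2_polyE big1 => [|j _]; last by rewrite subrr expr0n.
  by rewrite exprn_gt0// divr_gt0.
pose s2 := Num.min 1 (s0 + t).
have [s21 s20] : s2 <= 1 /\ s2 <= s0 + t by rewrite !ge_min !lexx orbT.
have s02 : s0 <= s2 by rewrite le_min s01 lerDl ltW.
have t2 : t <= s2 by rewrite le_min t1 lerDr.
exists a, A, (s2 - t / 2), s2; split; first by split=> //; exact: Sy.
split=> //; [lra | lra |].
move=> s H i /andP[ss2 s2s] AH.
have [j [c [c1 rE]]] := root_refl_coord i pa.
rewrite !segmentE !rE.
rewrite (_ : _ - _ = (s0 - s) * (X 0 i - c * y 0 j) + s * c * (H 0 j - y 0 j)); last by ring.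
apply: le_trans (ler_normD _ _) _; rewrite [leRHS](splitr eps).
have ss : 0 <= s by lra.
apply: lerD; rewrite !normrM.
  apply: le_trans tC; apply: ler_pM => //.
    by rewrite ler_norml; apply/andP; split; lra.
  apply: le_trans (ler_normB _ _) _; rewrite normrM c1 mul1r.
  by rewrite ler_wpDr// lerD// coord_le_norm1.
rewrite c1 mulr1 (ger0_norm ss) -[leRHS]mul1r; apply: ler_pM => //.
  exact: le_trans s2s s21.
by apply/ltW/dist2_lt_coord => //; rewrite divr_ge0// ltW.
Qed.

End Support.

(** * Convex sets *)

Section Convexity.
Context {R : realType} {q : nat}.
Implicit Types (x y z : 'rV[R]_q) (A S : set 'rV[R]_q).

Lemma convex_setE A : @convex_set R 'rV[R]_q A <->
  forall x y (t : R), 0 <= t <= 1 -> A x -> A y -> A (t *: x + (1 - t) *: y).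
Proof.
split=> [cA x y t /andP[t0 t1] Ax Ay|cA x y t].
  by have := cA x y (Itv01 t0 t1) (mem_set Ax) (mem_set Ay); rewrite inE.
rewrite !inE => Ax Ay; apply: cA => //.
by apply/andP; split; [exact: ge0 | exact: le1].
Qed.

(** The points of [S] from which all of [S] is visible. *)
Definition star_kernel S : set 'rV[R]_q :=
  [set y | forall z (s : R), S z -> 0 <= s <= 1 -> S ((1 - s) *: y + s *: z)].

(** To go from [t x + (1 - t) y] towards [z], aim from [x] at a point of the
    segment from [y] to [z]. *)
Lemma star_kernel_convex S z0 : S z0 -> @convex_set R 'rV[R]_q (star_kernel S).
Proof.
move=> Sz0; apply/convex_setE => x y t /andP[t0 t1] Kx Ky z s Sz /andP[s0 s1].
pose w := (1 - s) * (1 - t) + s.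
have w0 : 0 <= w by rewrite addr_ge0// mulr_ge0// subr_ge0.
have w1 : 1 - w = (1 - s) * t by rewrite /w; ring.
have w1' : w <= 1 by rewrite -subr_ge0 w1 mulr_ge0// subr_ge0.
have [w_eq0|wN0] := eqVneq w 0.
  have st0 : 0 <= (1 - s) * (1 - t) by rewrite mulr_ge0// subr_ge0.
  have s_eq0 : s = 0 by apply: le_anti; rewrite s0 andbT -w_eq0 lerDr.
  have t_eq1 : t = 1 by move: w1; rewrite w_eq0 s_eq0 !subr0 mul1r => ->.
  have := Kx _ 0 Sz0; rewrite s_eq0 t_eq1 subr0 subrr !scale0r !scale1r !addr0.
  by apply; rewrite lexx ler01.
have -> : (1 - s) *: (t *: x + (1 - t) *: y) + s *: z =
    (1 - w) *: x + w *: ((1 - s / w) *: y + (s / w) *: z).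
  rewrite w1 scalerDr scalerA -addrA; congr (_ + _).
  rewrite scalerDr !scalerA; congr (_ *: _ + _ *: _); rewrite /w in wN0 *; field.
    by [].
  by [].
apply: Kx; last by rewrite w0.
apply: Ky => //; rewrite divr_ge0//= ler_pdivrMr ?mul1r ?lt0r ?wN0//.
by rewrite lerDr mulr_ge0// subr_ge0.
Qed.

Lemma convex_combination A m (P : 'I_m -> 'rV[R]_q) (c : 'I_m -> R) :
    @convex_set R 'rV[R]_q A -> (forall i, A (P i)) ->
    (forall i, 0 <= c i) -> \sum_i c i = 1 ->
  A (\sum_i c i *: P i).
Proof.
move=> /convex_setE cA AP c0 c1.
suff H (r : seq 'I_m) : 0 < \sum_(i <- r) c i ->
    A ((\sum_(i <- r) c i)^-1 *: \sum_(i <- r) c i *: P i).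
  by have := H (index_enum 'I_m); rewrite c1 invr1 scale1r; exact.
elim: r => [|i r IH]; first by rewrite big_nil ltxx.
rewrite !big_cons; set u := \sum_(j <- r) c j; set v := \sum_(j <- r) _ *: _.
have u0 : 0 <= u by rewrite sumr_ge0.
rewrite le_eqVlt in u0; case/predU1P: u0 => [u0|u0].
  have -> : v = 0.
    have c_eq0 : all (fun j => true ==> (c j == 0)) r.
      by rewrite -psumr_eq0 => [|j _]; [rewrite -/u -u0 | exact: c0].
    rewrite /v big_seq big1 // => j jr.
    by rewrite (eqP (allP c_eq0 j jr)) scale0r.
  by rewrite -u0 !addr0 => ci0; rewrite scalerA mulVf ?scale1r ?gt_eqF.
move=> ciu0; have -> : (c i + u)^-1 *: (c i *: P i + v) =
    (c i / (c i + u)) *: P i + (1 - c i / (c i + u)) *: (u^-1 *: v).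
  rewrite scalerDr !scalerA; congr (_ *: _ + _ *: _); first by rewrite mulrC.
  by field; rewrite !gt_eqF.
apply: cA; [|exact: AP|exact: IH].
by rewrite divr_ge0 ?(ltW ciu0)//= ler_pdivrMr// mul1r lerDl ltW.
Qed.

Lemma root_app_subZ x y (t : R) : root_app (x - t *: y) (x - t *: y) =
  root_app x x - 2 * t * root_app x y + t ^+ 2 * root_app y y.
Proof.
rewrite root_appDl !root_appDr !root_appNl !root_appNr !root_appZl !root_appZr.
by rewrite (root_appC y x); ring.
Qed.

(** The nearest point of the hull of the [P i], which is compact, gives the
    separating linear form. *)
Lemma separation m (P : 'I_m -> 'rV[R]_q) (i0 : 'I_m) A y :
    @convex_set R 'rV[R]_q A -> (forall i, A (P i)) -> ~ A y ->
  exists l (M : R), (forall i, root_app l (P i) <= M) /\ M < root_app l y.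
Proof.
move=> cA AP nAy.
pose simplex := [set c : 'rV[R]_m | (forall i, `[0, 1]%classic (c ord0 i)) /\
  \sum_i c ord0 i = 1].
have simplex_compact : compact simplex.
  have box := @rV_compact R m (fun=> `[0, 1]%classic) (fun=> @segment_compact R 0 1).
  apply: (subclosed_compact _ box) => [|c []//].
  apply: closedI; first exact: compact_closed box.
  pose sum_poly : polyCq R m := \sum_i polyCqX i.
  have sum_polyE (c : 'rV[R]_m) : sum_poly.@Cq[c] = \sum_i c 0 i.
    by rewrite meval_sum; apply: eq_bigr => i _; rewrite mevalXU.
  have -> : (fun c : 'rV[R]_m => \sum_i c ord0 i = 1) =
      (fun c => sum_poly.@Cq[c]) @^-1` [set 1].
    by apply/funext => c /=; rewrite sum_polyE.
  apply: closed_comp => [c _|]; first exact: meval_continuous.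
  exact: closed_eq.
have delta_sum1 i : \sum_j (delta_mx 0 i : 'rV[R]_m) 0 j = 1.
  rewrite (bigD1 i)//= big1 => [|j /negbTE ji]; first by rewrite mxE !eqxx addr0.
  by rewrite mxE ji andbF.
pose comb (c : 'rV[R]_m) := \sum_i c 0 i *: P i.
pose dist (c : 'rV[R]_m) := root_app (y - comb c) (y - comb c).
have dist_cont : continuous dist.
  pose dist_poly : polyCq R m := \sum_j
    (mpolyC m (y 0 j) - \sum_i P i 0 j *: polyCqX i) ^+ 2.
  have -> : dist = fun c => dist_poly.@Cq[c]; last exact: meval_continuous.
  apply/funext => c; rewrite meval_sum; apply: eq_bigr => j _.
  rewrite rmorphXn /= mevalB mevalC meval_sum expr2 !mxE !summxE.
  congr ((_ - _) * (_ - _)); apply: eq_bigr => i _;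
    by rewrite mevalZ mevalXU mxE mulrC.
have [c0 + c0_min] : exists2 c, c \in simplex & forall t, t \in simplex -> dist c <= dist t.
  apply: compact_EVT_min => //; last exact: continuous_subspaceT.
  exists (delta_mx 0 i0); split; last exact: delta_sum1.
  by move=> i; rewrite /= in_itv /= mxE ler0n lern1 leq_b1.
rewrite inE => -[c0_itv c0_sum].
have c0_ge0 i : 0 <= c0 0 i by have := c0_itv i; rewrite /= in_itv /= => /andP[].
pose l := y - comb c0; exists l, (root_app l (comb c0)); split=> [i|].
  rewrite -subr_le0 -root_appNr -root_appDr; set v := P i - comb c0.
  have [//|a0] := leP (root_app l v) 0.
  have b0 : 0 <= root_app v v by apply: sumr_ge0 => j _; rewrite -expr2 sqr_ge0.
  pose t : R := Num.min 1 (root_app l v / (root_app v v + 1)).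
  have t0 : 0 < t by rewrite lt_min ltr01 divr_gt0// ltr_wpDl.
  have t1 : t <= 1 by rewrite ge_min lexx.
  have tb : t * (root_app v v + 1) <= root_app l v.
    by rewrite -ler_pdivlMr ?ltr_wpDl// ge_min lexx orbT.
  pose ct : 'rV[R]_m := (1 - t) *: c0 + t *: delta_mx 0 i.
  have delta_sum (F : 'I_m -> 'rV[R]_q) : \sum_j (delta_mx 0 i : 'rV[R]_m) 0 j *: F j = F i.
    rewrite (bigD1 i)//= big1 => [|j /negbTE ji].
      by rewrite mxE !eqxx scale1r addr0.
    by rewrite mxE ji andbF scale0r.
  have ctE : y - comb ct = l - t *: v.
    rewrite /comb /ct.
    rewrite (eq_bigr (fun j => (1 - t) *: (c0 0 j *: P j) +
       t *: ((delta_mx 0 i : 'rV[R]_m) 0 j *: P j))); last first.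
      by move=> j _; rewrite !scalerA -scalerDl segmentE.
    rewrite big_split -!scaler_sumr delta_sum /l /v -/(comb c0).
    by apply/rowP => j; rewrite !mxE; ring.
  have ct_simplex : ct \in simplex.
    rewrite inE; split=> [j|].
      have dj : 0 <= (delta_mx 0 i : 'rV[R]_m) 0 j <= 1.
        by rewrite mxE ler0n lern1 leq_b1.
      have := c0_itv j; rewrite /= !in_itv /= /ct segmentE => /andP[c1 c2].
      case/andP: dj => d1 d2; apply/andP; split.
        by rewrite addr_ge0// mulr_ge0// ?subr_ge0// ltW.
      by nra.
    rewrite (eq_bigr (fun j => (1 - t) * c0 0 j + t * (delta_mx 0 i : 'rV[R]_m) 0 j)).
      by rewrite big_split /= -!mulr_sumr c0_sum delta_sum1 !mulr1 subrK.
    by move=> j _; exact: segmentE.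
  have := c0_min _ ct_simplex; rewrite /dist ctE -/l root_app_subZ.
  by move=> H; exfalso; nra.
rewrite -subr_gt0 -root_appNr -root_appDr -/l.
have l0 : 0 <= root_app l l by apply: sumr_ge0 => j _; rewrite -expr2 sqr_ge0.
rewrite lt0r l0 andbT; apply/eqP => l_eq0; apply: nAy.
have -> : y = comb c0.
  apply/eqP; rewrite -subr_eq0 -/l; apply/eqP/rowP => j; rewrite [RHS]mxE.
  apply/eqP; rewrite -sqrf_eq0 expr2.
  have /eqP := l_eq0; rewrite psumr_eq0 => [|k _]; last by rewrite -expr2 sqr_ge0.
  by move/allP/(_ j (mem_index_enum _)).
exact: convex_combination.
Qed.

End Convexity.

(** * The support is the convex hull of the orbit *)

Section ConvexHull.
Context {R : realType} {q : nat}.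
Implicit Types (x y : 'rV[R]_q) (f g : polyCq R q).
Variables (d : nat) (p : R) (V : {linear polyCq R q -> polyCq R q}).
Hypothesis weight_gt0 :
  forall a : refl_index q, proper_index a -> 0 < bc_weight d p a.
Hypothesis V_intertwiner : is_dunkl_intertwiner d p V.
Variables (X : 'rV[R]_q) (mu : probability (borelCq R q) R).
Hypothesis mu_V : represents V X mu.
Hypothesis q_gt0 : (0 < q)%N.
Let S : set 'rV[R]_q := measure_support (mu : set 'rV[R]_q -> \bar R).

Lemma support_signed_perm s e y : S y -> S (signed_perm s e y).
Proof.
apply: signed_perm_stable => a x pa Sx.
have s01 : 0 <= (1 : R) <= 1 by rewrite ler01 lexx.
have := support_step weight_gt0 V_intertwiner mu_V pa s01 Sx.
by rewrite subrr scale0r add0r scale1r.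
Qed.

(** Around [X]: reach [z] through [r z], as [r] is an involution.  Around the
    other points of the orbit: apply the Weyl group, which preserves the
    support. *)
Lemma star_kernel_orbit y : weyl_orbit X y -> star_kernel S y.
Proof.
have XK : star_kernel S X.
  move=> z s Sz s01; pose a : refl_index q := inl (Ordinal q_gt0).
  have pa : proper_index a by [].
  have aE x : root_refl (bc_root a) x = signed_perm 1 [ffun k => k == Ordinal q_gt0] x.
    exact: root_refl_h.
  have aK : root_refl (bc_root a) (root_refl (bc_root a) z) = z.
    rewrite !aE signed_perm_comp mulg1 -[RHS]signed_perm1; congr signed_perm.
    by apply/ffunP => k; rewrite !ffunE perm1 addbb.
  have Saz : S (root_refl (bc_root a) z) by rewrite aE; exact: support_signed_perm.
  have := support_step weight_gt0 V_intertwiner mu_V pa s01 Saz.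
  by rewrite aK.
move=> [s [e ->]] z t Sz t01; rewrite -/(signed_perm s e X).
rewrite -[z](signed_perm_invK s e) -[(1 - t) *: _]signed_permZ.
rewrite -[t *: signed_perm s e _]signed_permZ -signed_permD.
by apply: support_signed_perm; apply: XK => //; exact: support_signed_perm.
Qed.

Lemma conv_hull_support : conv_hull (weyl_orbit X) `<=` S.
Proof.
have SX : S X := support_basepoint weight_gt0 V_intertwiner mu_V q_gt0.
have : conv_hull (weyl_orbit X) `<=` star_kernel S.
  by apply: smallest_sub; [exact: star_kernel_convex SX | exact: star_kernel_orbit].
move=> hullK y /hullK/(_ X 0 SX).
by rewrite subr0 scale1r scale0r addr0; apply; rewrite lexx ler01.
Qed.

Lemma support_conv_hull : S `<=` conv_hull (weyl_orbit X).
Proof.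
move=> y Sy; apply: contrapT => ny.
pose W := ('S_q * {ffun 'I_q -> bool})%type.
pose P (i : 'I_#|{: W}|) : 'rV[R]_q := signed_perm (enum_val i).1 (enum_val i).2 X.
have PE s e : signed_perm s e X = P (enum_rank (s, e)) by rewrite /P enum_rankK.
have hull_convex : @convex_set R 'rV[R]_q (conv_hull (weyl_orbit X)).
  apply/convex_setE => x z t t01 Hx Hz B [cB XB].
  have /convex_setE := cB; apply => //; [exact: (Hx B) | exact: (Hz B)].
have hullP i : conv_hull (weyl_orbit X) (P i).
  apply: sub_gen_smallest; exists (enum_val i).1, (enum_val i).2; reflexivity.
have [l [M [lM ly]]] :=
  separation (enum_rank ((1%g, [ffun=> false]) : W)) hull_convex hullP ny.
have lM' s e : `|root_app l (signed_perm s e X)| <= M.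
  rewrite ler_norml PE lM andbT lerNl -root_appNr.
  have -> : - P (enum_rank (s, e)) = P (enum_rank (s, [ffun i => ~~ e i])).
    rewrite -!PE; apply/rowP => i; rewrite !mxE ffunE signrN mulNr.
    by [].
  exact: lM.
have M0 : 0 <= M by apply: le_trans (lM' 1%g [ffun=> false]).
(* c is a threshold strictly between M ^ 2 and the value of l ^ 2 at y *)
pose c := (M ^+ 2 + root_app l y ^+ 2) / 2.
have Mly : M ^+ 2 < root_app l y ^+ 2.
  by rewrite ltr_pXn2r ?nnegrE// (le_trans M0)// ltW.
have Mc : M ^+ 2 < c by rewrite /c; lra.
have oc := @meval_gt_open R q (root_poly l ^+ 2) c.
have := tail_negligible weight_gt0 V_intertwiner mu_V lM' Mc.
move=> /negligibleP => /(_ (open_measurable_Cq oc)) mu0.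
have := Sy _ oc; rewrite /= rmorphXn /= root_polyE => /(_ _); rewrite mu0 ltxx.
by move=> H; have : false by apply: H; rewrite /c; lra.
Qed.

End ConvexHull.

Theorem corollary26 (R : realType) (d q : nat) (p : R)
    (hd : d \in [:: 1; 2; 4]%N) (hq : (1 <= q)%N) (hp : 2 * q%:R - 1 < p)
    (V : {linear polyCq R q -> polyCq R q})
    (hV : is_dunkl_intertwiner d p V)
    (X : 'rV[R]_q) (hX : pos_chamber X)
    (mu : probability (borelCq R q) R)
    (hmu_compact : compact (measure_support mu))
    (hmu : represents V X mu) :
  measure_support mu = conv_hull (weyl_orbit X).
Proof.
have weight_gt0 (a : refl_index q) : proper_index a -> 0 < bc_weight d p a.
  exact: bc_weight_proper.
apply/seteqP; split.
  exact (support_conv_hull weight_gt0 hV hmu).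
exact (conv_hull_support weight_gt0 hV hmu hq).
Qed.
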